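(* Consider the dyadic linear model described in the context, and suppose that the dependence assumption (DEP) and the bounded support assumption (BS) hold. Suppose moreover that at least one of the following three sets of conditions holds: (i) there is a constant $D$ such that $\mathcal{M}^H < D$ for all $G$, and the limit $\Omega := \lim_{G\to\infty} \frac{1}{N}\mathrm{Var}\big(\sum_{n=1}^N \mathbf{x}_n u_n\big)$ exists and is positive definite; (ii) there is a constant $c>0$ such that $\mathcal{M}^L \ge cG$ for all $G$, and the limit $\Omega := \lim_{G\to\infty} \frac{1}{NG}\mathrm{Var}\big(\sum_{n=1}^N \mathbf{x}_n u_n\big)$ exists and is positive definite; (iii) there is a constant $c>0$ such that $\mathcal{M}^L \ge cG$ for all $G$, and for some $r\in[0,1]$ with $r>\frac12$ the limit $\Omega := \lim_{G\to\infty} \frac{1}{NG^{r}}\mathrm{Var}\big(\sum_{n=1}^N \mathbf{x}_n u_n\big)$ exists and is positive definite. Then, for each $k\in\{1,\dots,K\}$, as $G\to\infty$, $$T_k = \frac{\hat\beta_k-\beta_k}{\sqrt{\hat V_{kk}}} \xrightarrow{d} N(0,1).$$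
   Context: Setup. For each $G$ there are units $g=1,\dots,G$. The data are indexed by dyads, i.e. unordered pairs $\{g,h\}$ of distinct units; not every pair need form a dyad, and the (nonrandom) set of dyads may vary with $G$. The dyads present are enumerated $n=1,\dots,N$ (with $N=N_G$), each present pair corresponding to exactly one index, and $\psi(n)=\{g,h\}$ denotes the pair of units forming dyad $n$. $M_g$ is the number of dyads containing unit $g$, $\mathcal{M}^H=\max_g M_g$ and $\mathcal{M}^L=\min_g M_g$. Asymptotics are as $G\to\infty$, with $N\to\infty$. Model. $y_n=\beta'\mathbf{x}_n+u_n$, $n=1,\dots,N$, where $\mathbf{x}_n$ is a $K$-dimensional random vector ($K$ fixed), $u_n$ is a scalar random variable, $\beta\in\mathbb{R}^K$ is fixed, $E[\mathbf{x}_nu_n]=\mathbf{0}$, and $E[\mathbf{x}_n\mathbf{x}_n']$ is positive definite. (DEP) The $(\mathbf{x}_n,u_n)$, $n=1,\dots,N$, are identically distributed (with a common law not depending on $G$). For any two disjoint subsets $S_1,S_2$ of $\{1,\dots,N\}$, $\{(\mathbf{x}_n,u_n)\}_{n\in S_1}$ is independent of $\{(\mathbf{x}_m,u_m)\}_{m\in S_2}$ whenever $\psi(n)\cap\psi(m)=\emptyset$ for every $n\in S_1$, $m\in S_2$. (BS) $\{(\mathbf{x}_n,u_n)\}_{n=1}^N$ have support bounded uniformly in $n$ and $N$: there is a finite constant bounding $\|\mathbf{x}_n\|$ and $|u_n|$ almost surely for all $n$ and $N$. Estimators. $\hat\beta=\big(\sum_{n=1}^N\mathbf{x}_n\mathbf{x}_n'\big)^{-1}\sum_{n=1}^N\mathbf{x}_ny_n$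 is the OLS estimator with components $\hat\beta_1,\dots,\hat\beta_K$; $\hat u_n=y_n-\hat\beta'\mathbf{x}_n$; $\mathbf{1}_{n,m}$ equals $1$ if $\psi(n)\cap\psi(m)\neq\emptyset$ and $0$ otherwise. The dyadic-robust variance estimator is $$\hat V=\Big(\sum_{n=1}^N\mathbf{x}_n\mathbf{x}_n'\Big)^{-1}\Big(\sum_{n=1}^N\sum_{m=1}^N\mathbf{1}_{n,m}\hat u_n\hat u_m\mathbf{x}_n\mathbf{x}_m'\Big)\Big(\sum_{n=1}^N\mathbf{x}_n\mathbf{x}_n'\Big)^{-1},$$ and $\hat V_{kk}$ is its $k$th diagonal entry. On events where an inverse does not exist or $\hat V_{kk}\le 0$, the corresponding quantities are defined arbitrarily. *)

(* Defs.v *)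
From HB Require Import structures.
From mathcomp Require Import all_boot all_order all_algebra.
From mathcomp Require Import all_classical all_reals all_analysis.

Set Implicit Arguments.
Unset Strict Implicit.
Unset Printing Implicit Defensive.

Import Order.TTheory GRing.Theory Num.Theory.
Import numFieldNormedType.Exports.

Local Open Scope classical_set_scope.
Local Open Scope ring_scope.

Section Dyads.
Variables (G N : nat) (psi : 'I_N -> {set 'I_G}).

Definition dyad_enumeration : Prop :=
  injective psi /\ forall n, #|psi n| = 2%N.

Definition share_unit (n m : 'I_N) : bool := ~~ [disjoint psi n & psi m].

Definition dyads_of (g : 'I_G) : nat := #|[pred n | g \in psi n]|.

Definition max_dyads_of : nat := \max_(g < G) dyads_of g.

(* Every [dyads_of g] is at most [N], so for [0 < G] the default value [N]
   does not affect the minimum. *)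
Definition min_dyads_of : nat := \big[minn/N]_(g < G) dyads_of g.

End Dyads.

Definition posdef (R : realType) (K : nat) (A : 'M[R]_K) : Prop :=
  A^T = A /\ forall v : 'cV[R]_K, v != 0 -> 0 < (v^T *m A *m v) 0 0.

Definition dot (R : realType) (K : nat) (a b : 'cV[R]_K) : R := (a^T *m b) 0 0.

Definition euclidean_norm (R : realType) (K : nat) (a : 'cV[R]_K) : R :=
  Num.sqrt (dot a a).

(* [K.-tuple R] carries the product sigma-algebra and is the value space of the
   regressors; the algebra is done on column vectors. *)
Definition vec (R : realType) (K : nat) (a : K.-tuple R) : 'cV[R]_K :=
  \col_i tnth a i.

(* The estimators as functions of a realized sample. [invmx A] is the inverse of
   [A] when [A \in unitmx]. *)
Section Estimators.
Variables (R : realType) (K G N : nat) (psi : 'I_N -> {set 'I_G}).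
Variables (x : 'I_N -> 'cV[R]_K) (y : 'I_N -> R).

Definition gram : 'M[R]_K := \sum_n x n *m (x n)^T.

Definition ols : 'cV[R]_K := invmx gram *m \sum_n y n *: x n.

Definition residual (n : 'I_N) : R := y n - dot ols (x n).

Definition dyadic_robust_var : 'M[R]_K :=
  invmx gram
  *m (\sum_n \sum_m
        ((share_unit psi n m)%:R * residual n * residual m)
          *: (x n *m (x m)^T))
  *m invmx gram.

End Estimators.

Section Randomness.
Variables (d : measure_display) (T : measurableType d) (R : realType).
Variable P : probability T R.

Definition mean_mx (K L : nat) (A : T -> 'M[R]_(K, L)) : 'M[R]_(K, L) :=
  \matrix_(i, j) fine 'E_P[fun w => A w i j].

Definition var_mx (K : nat) (S : T -> 'cV[R]_K) : 'M[R]_K :=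
  \matrix_(i, j) fine (covariance P (fun w => S w i 0) (fun w => S w j 0)).

(* The sigma-algebra generated by the subfamily of [Z] indexed by [S]. *)
Definition generated_sigma (d' : measure_display) (T' : measurableType d')
    (I : finType) (Z : I -> T -> T') (S : {set I}) : set (set T) :=
  <<s \bigcup_(i in [set` S]) preimage_set_system setT (Z i) measurable >>.

Definition independent_subfamilies (d' : measure_display)
    (T' : measurableType d') (I : finType) (Z : I -> T -> T')
    (S1 S2 : {set I}) : Prop :=
  forall A B : set T, generated_sigma Z S1 A -> generated_sigma Z S2 B ->
    P (A `&` B) = (P A * P B)%E.

End Randomness.

Definition cvg_in_distribution (R : realType) (d : nat -> measure_display)
    (T : forall G, measurableType (d G)) (P : forall G, probability (T G) R)
    (X : forall G, {RV P G >-> R}) (mu : probability (measurableTypeR R) R) : Prop :=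
  forall s : R, {for s, continuous (fun a : R => mu `]-oo, a]%classic)} ->
    cdf (X G) s @[G --> \oo] --> mu `]-oo, s]%classic.

Definition posdef_limit (R : realType) (K : nat) (A : nat -> 'M[R]_K) : Prop :=
  exists2 Omega : 'M[R]_K, A G @[G --> \oo] --> Omega & posdef Omega.

(* Main.v *)
(* Let S be a linear combination of the score sum s = sum_n u_n x_n, with terms Z_n,
   and let S_n be the sum of the Z_m over the dyads m sharing a unit with n. Since
   Z_n is independent of S - S_n, a second-order expansion in Stein's equation
   bounds the distance of S / sigma to N(0,1) by the standard deviation of
   sum_n Z_n S_n / sigma^2 and by E sum_n S_n^2 / sigma^3. Independence of
   unconnected pairs makes the first term O(sqrt (N D^3) / sigma^2), with D the
   largest number of dyads of a unit; this is where r > 1/2 is used. For the second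
   term write T_g for the sum of the Z_n over the dyads containing g: two distinct
   dyads share at most one unit, so sum_g E T_g^2 = sigma^2 + sum_n E Z_n^2, and
   S_n + Z_n = T_g + T_h for n = {g, h}, whence E sum_n S_n^2 = O(D sigma^2) and the
   term is O(D / sigma), in all three regimes at once.

   The same variance bound sqrt (N D^3) shows that the middle matrix of the variance
   estimator, with the true errors, has the variance of s as its asymptotic
   equivalent; replacing errors by residuals costs O(D / a) |beta_hat - beta|, where
   N a is the order of that variance, and this tends to 0 in probability. Convergence
   in probability is phrased as convergence along a filter, so that Slutsky's
   arguments are continuity arguments. *)

Require Import Defs.
From HB Require Import structures.
From mathcomp Require Import all_boot all_order all_algebra.
From mathcomp Require Import all_classical all_reals all_analysis.
From mathcomp Require Import measurable_realfun ring lra.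

Set Implicit Arguments.
Unset Strict Implicit.
Unset Printing Implicit Defensive.

Import Order.TTheory GRing.Theory Num.Theory.
Import numFieldNormedType.Exports.

Local Open Scope classical_set_scope.
Local Open Scope ring_scope.

(** * Expectations of bounded random variables *)

(** The three regimes enter only through two sequences: [a], with [N * a] the order of the variance,
    and [Dl], a bound for the unit degrees. Under [1 <= a <= Dl] the single condition that
    [Dl ^+ 3 / (N * a ^+ 2)] vanishes controls every remainder: the law of large numbers for the
    Gram matrix needs [Dl / N], the estimation error and the third-order Stein term need
    [Dl ^+ 2 / (N * a)], and it dominates both. No moment of the t-statistic is taken, since the
    inverse Gram matrix is uncontrolled on small events. Stein's method is applied to a linear
    statistic, the score sum contracted with row [k] of the inverse of [Q], and the t-statistic is
    compared with it by inclusions that hold on events of high probability. The normalized scores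
    have bounded second moments but no limit in probability, so products with them get their own
    estimates. The sample spaces vary with [G], so the filter lives on pairs of an index and a
    sample point. Almost sure bounds become everywhere bounds by truncation; [bounded_mfun] then
    involves no measure, and integrability reduces to closure under algebra. *)

Definition bounded_mfun (R : realType) d (T : measurableType d) (X : T -> R) :=
  measurable_fun setT X /\ exists C, forall w, `|X w| <= C.

Section bounded_mfun_closure.
Context (R : realType) d (T : measurableType d).
Implicit Types X Y : T -> R.

Lemma bounded_mfun_cst (c : R) : bounded_mfun (fun _ : T => c).
Proof. by split; [exact: measurable_cst|exists `|c|]. Qed.

Lemma bounded_mfunD X Y : bounded_mfun X -> bounded_mfun Y ->
  bounded_mfun (fun w => X w + Y w).
Proof.
move=> [mX [C XC]] [mY [D YD]]; split; first exact: measurable_funD.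
by exists (C + D) => w; rewrite (le_trans (ler_normD _ _))// lerD.
Qed.

Lemma bounded_mfunM X Y : bounded_mfun X -> bounded_mfun Y ->
  bounded_mfun (fun w => X w * Y w).
Proof.
move=> [mX [C XC]] [mY [D YD]]; split; first exact: measurable_funM.
by exists (C * D) => w; rewrite normrM ler_pM.
Qed.

Lemma bounded_mfunN X : bounded_mfun X -> bounded_mfun (fun w => - X w).
Proof.
move=> [mX [C XC]]; split; first exact: measurableT_comp.
by exists C => w; rewrite normrN.
Qed.

Lemma bounded_mfunX X n : bounded_mfun X -> bounded_mfun (fun w => X w ^+ n).
Proof.
move=> bX; elim: n => [|n ih].
  by rewrite (_ : (fun _ => _) = fun=> 1); [exact: bounded_mfun_cst|].
rewrite (_ : (fun _ => _) = fun w => X w * X w ^+ n); first exact: bounded_mfunM.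
by apply/funext => w; rewrite exprS.
Qed.

Lemma bounded_mfun_norm X : bounded_mfun X -> bounded_mfun (fun w => `|X w|).
Proof.
move=> [mX [C XC]]; split; first exact: measurableT_comp.
by exists C => w; rewrite normr_id.
Qed.

Lemma bounded_mfun_sum (I : Type) (s : seq I) (p : pred I) (X : I -> T -> R) :
  (forall i, bounded_mfun (X i)) ->
  bounded_mfun (fun w => \sum_(i <- s | p i) X i w).
Proof.
move=> bX; elim: s => [|i s ih].
  under eq_fun do rewrite big_nil.
  exact: bounded_mfun_cst.
under eq_fun do rewrite big_cons.
by case: (p i) => //; exact: bounded_mfunD.
Qed.

Lemma bounded_mfun_comp (f : R -> R) X : continuous f ->
  (exists C, forall x, `|f x| <= C) -> bounded_mfun X ->
  bounded_mfun (fun w => f (X w)).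
Proof.
move=> cf [C fC] [mX _]; split; last by exists C.
by apply: (measurableT_comp _ mX); exact: continuous_measurable_fun.
Qed.

Lemma bounded_mfun_indic (A : set T) : measurable A -> bounded_mfun (\1_A : T -> R).
Proof.
move=> mA; split; first exact: measurable_indic.
exists 1 => w; rewrite indicE; case: (_ \in _); rewrite ?normr1 ?normr0//.
Qed.

End bounded_mfun_closure.

Ltac bounded_mfun_tac :=
  repeat first [ solve [auto] | exact: bounded_mfun_cst
    | apply: bounded_mfunD | apply: bounded_mfunM
    | apply: bounded_mfunN | apply: bounded_mfunX | apply: bounded_mfun_norm
    | apply: bounded_mfun_sum => ? ].

Section expectation_of_bounded.
Context (R : realType) d (T : measurableType d) (P : probability T R).
Implicit Types X Y : T -> R.

Definition expect X : R := \int[P]_w X w.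
Local Notation E := expect.

Lemma bounded_mfun_integrable X : bounded_mfun X ->
  P.-integrable setT (EFin \o X).
Proof.
move=> [mX [C XC]]; apply: measurable_bounded_integrable => //.
  by rewrite (le_lt_trans (probability_le1 _ _)) ?ltry.
exists C; split; first by rewrite num_real.
by move=> x Cx w _; exact: le_trans (XC w) (ltW Cx).
Qed.

Lemma expectD X Y : bounded_mfun X -> bounded_mfun Y ->
  E (fun w => X w + Y w) = E X + E Y.
Proof. by move=> /bounded_mfun_integrable ? /bounded_mfun_integrable ?; exact: RintegralD. Qed.

Lemma expectB X Y : bounded_mfun X -> bounded_mfun Y ->
  E (fun w => X w - Y w) = E X - E Y.
Proof. by move=> /bounded_mfun_integrable ? /bounded_mfun_integrable ?; exact: RintegralB. Qed.

Lemma expectZl c X : bounded_mfun X -> E (fun w => c * X w) = c * E X.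
Proof. by move=> /bounded_mfun_integrable ?; exact: RintegralZl. Qed.

Lemma expect_cst c : E (fun=> c) = c.
Proof.
rewrite /expect Rintegral_cst//.
by rewrite [X in fine X](_ : _ = 1%E) ?mulr1//; exact: probability_setT.
Qed.

Lemma expect_sum (I : Type) (s : seq I) (p : pred I) (X : I -> T -> R) :
  (forall i, bounded_mfun (X i)) ->
  E (fun w => \sum_(i <- s | p i) X i w) = \sum_(i <- s | p i) E (X i).
Proof.
move=> bX; elim: s => [|i s ih].
  under [X in E X]eq_fun do rewrite big_nil.
  by rewrite expect_cst big_nil.
rewrite big_cons -ih; under [X in E X]eq_fun do rewrite big_cons.
by case: (p i) => //; rewrite expectD//; exact: bounded_mfun_sum.
Qed.

Lemma le_expect X Y : bounded_mfun X -> bounded_mfun Y ->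
  (forall w, X w <= Y w) -> E X <= E Y.
Proof.
by move=> /bounded_mfun_integrable ? /bounded_mfun_integrable ? XY; exact: le_Rintegral.
Qed.

Lemma expect_ge0 X : (forall w, 0 <= X w) -> 0 <= E X.
Proof. by move=> X0; exact: Rintegral_ge0. Qed.

Lemma expect_bound X c : bounded_mfun X -> (forall w, `|X w| <= c) -> `|E X| <= c.
Proof.
move=> bX Xc; rewrite (le_trans (le_normr_Rintegral _ _))//.
  exact: bounded_mfun_integrable.
rewrite -[leRHS](expect_cst c); apply: le_expect => //; bounded_mfun_tac.
Qed.

Lemma normr_expect X : bounded_mfun X -> `|E X| <= E (fun w => `|X w|).
Proof. by move=> bX; apply: le_normr_Rintegral => //; exact: bounded_mfun_integrable. Qed.

Lemma expect_indic (A : set T) : measurable A -> E \1_A = fine (P A).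
Proof. by move=> mA; rewrite /expect /Rintegral integral_indic// setIT. Qed.

Lemma expect_ae X Y : measurable_fun setT X -> measurable_fun setT Y ->
  {ae P, forall w, X w = Y w} -> E X = E Y.
Proof.
move=> mX mY XY; congr fine; apply: ae_eq_integral => //.
- exact/measurable_EFinP.
- exact/measurable_EFinP.
- by apply: filterS XY => w /= -> _.
Qed.

Lemma markov_expect X e : bounded_mfun X -> (forall w, 0 <= X w) -> 0 < e ->
  e * fine (P [set w | e <= X w]) <= E X.
Proof.
move=> bX X0 e0.
have mA : measurable [set w | e <= X w].
  rewrite [X in measurable X](_ : _ = setT `&` X @^-1` `[e, +oo[); last first.
    by apply/seteqP; split => w /=; rewrite in_itv/= andbT; [split|case].
  by case: bX => mX _; exact: mX.
rewrite -expect_indic// -expectZl; last exact: bounded_mfun_indic.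
apply: le_expect => //.
  by apply: bounded_mfunM; [exact: bounded_mfun_cst|exact: bounded_mfun_indic].
move=> w; rewrite indicE; have [|_] := boolP (w \in _).
  by rewrite inE/= mulr1.
by rewrite mulr0.
Qed.

End expectation_of_bounded.

(** * Independence and products of expectations *)

Section independence.
Context (R : realType) d (T : measurableType d) (P : probability T R).
Local Notation E := (expect P).

(** Agreement on rectangles makes the law of the pair the product of the two marginal laws; Fubini
    then integrates [z.1 * z.2] against it. *)
Lemma expectM_indep (X Y : T -> R) : bounded_mfun X -> bounded_mfun Y ->
  (forall A B : set R, measurable A -> measurable B ->
    P (X @^-1` A `&` Y @^-1` B) = (P (X @^-1` A) * P (Y @^-1` B))%E) ->
  E (fun w => X w * Y w) = E X * E Y.
Proof.
move=> bX bY indXY.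
have [mX _] := bX; have [mY _] := bY.
have mXY : measurable_fun setT (fun w => (X w, Y w)).
  exact/measurable_fun_pair.
pose X' : {mfun T >-> R} := HB.pack X (isMeasurableFun.Build _ _ _ _ X mX).
pose Y' : {mfun T >-> R} := HB.pack Y (isMeasurableFun.Build _ _ _ _ Y mY).
pose XY : {mfun T >-> (R * R)%type} :=
  HB.pack (fun w => (X w, Y w)) (isMeasurableFun.Build _ _ _ _ _ mXY).
pose f (z : (R * R)%type) := (z.1 * z.2)%:E.
have mf : measurable_fun setT f.
  by apply/measurable_EFinP; exact: measurable_funM.
have if_ : P.-integrable setT (f \o XY).
  by have /(bounded_mfun_integrable P) := bounded_mfunM bX bY; exact.
pose XxY := (distribution P X' \x distribution P Y')%E.
have prodE (C : set (R * R)%type) : measurable C -> XxY C = distribution P XY C.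
  apply: product_measure_unique => A B mA mB.
  rewrite [LHS](_ : _ = P (X @^-1` A `&` Y @^-1` B)); first exact: indXY.
  by congr (P _); apply/seteqP; split.
have ifp : XxY.-integrable setT f.
  apply/integrableP; split => //.
  rewrite (eq_measure_integral (distribution P XY)); last by move=> ? ? _; exact: prodE.
  by have /integrableP[_] := integrable_pushforward mXY mf if_ measurableT.
have XYE : (\int[XxY]_z f z = \int[P]_w (X w * Y w)%:E)%E.
  rewrite (eq_measure_integral (distribution P XY)); last by move=> ? ? _; exact: prodE.
  by rewrite (integral_distribution (X := XY)).
rewrite /expect /Rintegral -XYE -integral12_prod_meas1//.
have iX := bounded_mfun_integrable P bX.
have iY := bounded_mfun_integrable P bY.
have eY x : (\int[distribution P Y']_y f (x, y) = x%:E * (E Y)%:E)%E.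
  rewrite (integral_distribution (X := Y'))/=.
  - under eq_integral do rewrite /f EFinM.
    rewrite integralZl// /expect /Rintegral fineK//.
    exact: integrable_fin_num.
  - by rewrite /f/=; apply/measurable_EFinP; exact: mulrl_measurable.
  - by have /(bounded_mfun_integrable P) := bounded_mfunM (bounded_mfun_cst T x) bY; exact.
rewrite (_ : fubini_F _ f = fun x => (x * E Y)%:E); last first.
  by apply/funext => x; rewrite EFinM; exact: eY.
rewrite (integral_distribution (X := X'))/=.
- rewrite -[RHS]mulrC -RintegralZl// /Rintegral; congr fine.
  by apply: eq_integral => w _; rewrite mulrC.
- by apply/measurable_EFinP; exact: mulrr_measurable.
- by apply: bounded_mfun_integrable; bounded_mfun_tac.
Qed.

Lemma measurable_fun_sub_g_sigma (T0 : pointedType) d' (T' : measurableType d')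
    (G H : set (set T0)) (X : T0 -> T') :
  G `<=` <<s H >> ->
  measurable_fun setT (X : g_sigma_algebraType G -> T') ->
  measurable_fun setT (X : g_sigma_algebraType H -> T').
Proof.
move=> GH mX _ B mB; have := mX measurableT B mB.
by apply: smallest_sub => //; exact: smallest_sigma_algebra.
Qed.

Variables (d' : measure_display) (T' : measurableType d') (I : finType).
Variable Z : I -> T -> T'.
Hypothesis mZ : forall i, measurable_fun setT (Z i).

Definition generators (S : {set I}) : set (set T) :=
  \bigcup_(i in [set` S]) preimage_set_system setT (Z i) measurable.

(** Measurability is with respect to the sigma-algebra generated by the [Z i], [i] in [S]. Reusing
    [bounded_mfun] on [T] with that sigma-algebra makes its closure lemmas available for [known]. *)
Definition known (S : {set I}) (X : T -> R) :=
  bounded_mfun (X : g_sigma_algebraType (generators S) -> R).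

Lemma known_bounded_mfun S X : known S X -> bounded_mfun X.
Proof.
move=> [mX bX]; split => // _ B mB; have := mX measurableT B mB.
rewrite setTI; apply: smallest_sub; first exact: sigma_algebra_measurable.
by move=> A [i _ [C mC <-]]; exact: mZ.
Qed.

Lemma known_sub (S S' : {set I}) X : S \subset S' -> known S X -> known S' X.
Proof.
move=> SS' [mX bX]; split => //.
apply: measurable_fun_sub_g_sigma mX => A [i Si SA].
apply: sub_sigma_algebra; exists i => //.
exact: (fintype.subsetP SS').
Qed.

Lemma known_comp (S : {set I}) i (g : T' -> R) : i \in S -> measurable_fun setT g ->
  (exists C, forall z, `|g z| <= C) -> known S (fun w => g (Z i w)).
Proof.
move=> iS mg [C gC]; split; last by exists C.
move=> _ B mB; apply: sub_sigma_algebra; exists i => //.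
exists (g @^-1` B); last by rewrite !setTI.
by rewrite -[X in measurable X]setTI; exact: mg.
Qed.

Lemma expectM_known S1 S2 X Y : independent_subfamilies P Z S1 S2 ->
  known S1 X -> known S2 Y -> E (fun w => X w * Y w) = E X * E Y.
Proof.
move=> ind kX kY; apply: expectM_indep.
- exact: known_bounded_mfun kX.
- exact: known_bounded_mfun kY.
move=> A B mA mB; apply: ind.
- by have [mX _] := kX; have := mX measurableT A mA; rewrite setTI.
- by have [mY _] := kY; have := mY measurableT B mB; rewrite setTI.
Qed.

End independence.

(** * Stein's equation *)

Section real_derivatives.
Context {R : realType}.
Implicit Types f g : R -> R.

Lemma is_derive_cstf (c x : R) : is_derive x 1 (fun _ : R => c) 0.
Proof. exact: is_derive_cst. Qed.

Lemma is_derive_addf f g (x a b : R) : is_derive x 1 f a -> is_derive x 1 g b ->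
  is_derive x 1 (fun y => f y + g y) (a + b).
Proof. by move=> fa gb; exact: is_deriveD. Qed.

Lemma is_derive_mulf f g (x a b : R) : is_derive x 1 f a -> is_derive x 1 g b ->
  is_derive x 1 (fun y => f y * g y) (a * g x + f x * b).
Proof.
move=> fa gb; apply: is_derive_eq.
by rewrite /GRing.scale/= addrC [g x * a]mulrC.
Qed.

Lemma is_derive_compf f g (x a b : R) : is_derive x 1 f a ->
  is_derive (f x) 1 g b -> is_derive x 1 (fun y => g (f y)) (b * a).
Proof.
by move=> fa gb; exact: is_derive1_comp.
Qed.

Lemma is_derive_continuous f df : (forall x : R, is_derive x 1 f (df x)) ->
  continuous f.
Proof.
move=> ff x; apply: differentiable_continuous; apply/derivable1_diffP.
by have [] := ff x.
Qed.

Lemma mean_value f df (a b : R) : (forall x : R, is_derive x 1 f (df x)) ->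
  a <= b -> exists2 c, a <= c <= b & f b - f a = df c * (b - a).
Proof.
move=> ff ab; have [] := @MVT_segment R f df a b ab.
- by apply: continuous_subspaceT; exact: is_derive_continuous ff.
- by move=> c; rewrite in_itv/= => cab ->; exists c.
Qed.

Lemma lipschitz_of_derive f df (L : R) : (forall x : R, is_derive x 1 f (df x)) ->
  (forall x, `|df x| <= L) -> forall x y, `|f x - f y| <= L * `|x - y|.
Proof.
move=> ff dfL x y; wlog yx : x y / y <= x => [wl|].
  have [/wl//|/ltW/wl xy] := leP y x.
  by rewrite distrC (distrC x).
have [c _ ->] := mean_value ff yx.
by rewrite normrM ler_wpM2r.
Qed.

(** The mean value theorem gives [df] at an intermediate point, and the Lipschitz bound moves it to
    [x]. This loses the factor 1/2 of the sharp remainder but asks for no second derivative. *)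
Lemma taylor_bound f df (L : R) : (forall x : R, is_derive x 1 f (df x)) ->
  (forall x y, `|df x - df y| <= L * `|x - y|) ->
  forall x y, `|f x - f y - (x - y) * df x| <= L * (x - y) ^+ 2.
Proof.
move=> ff dfL x y.
have L0 : 0 <= L.
  by have := dfL 1 0; rewrite subr0 normr1 mulr1; apply: le_trans.
have sqn : (x - y) ^+ 2 = `|x - y| * `|x - y| by rewrite -normrM -expr2 ger0_norm ?sqr_ge0.
have [xy|/ltW xy] := leP y x.
- have [c /andP[yc cx] ->] := mean_value ff xy.
  rewrite [(x - y) * df x]mulrC -mulrBl normrM sqn mulrA ler_wpM2r//.
  rewrite (le_trans (dfL _ _))// ler_wpM2l// distrC !ger0_norm ?subr_ge0// ?lerB//.
- have [c /andP[xc cy] E] := mean_value ff xy.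
  have -> : f x - f y - (x - y) * df x = (df c - df x) * (x - y).
    have -> : f x - f y = - (f y - f x) by ring.
    by rewrite E; ring.
  rewrite normrM sqn mulrA ler_wpM2r//.
  rewrite (le_trans (dfL _ _))// ler_wpM2l// [leRHS]distrC !ger0_norm ?subr_ge0//.
  by rewrite lerB.
Qed.

Lemma lipschitz_continuous_fun f (C : R) : 0 <= C ->
  (forall x y, `|f x - f y| <= C * `|x - y|) -> continuous f.
Proof.
move=> C0 fL x; apply/cvgrPdist_le => e e0.
have C1 : 0 < C + 1 by rewrite ltr_wpDl.
have : y @[y --> x] --> x by exact: cvg_id.
move=> /cvgrPdist_le/(_ (e / (C + 1)) (divr_gt0 e0 C1)).
apply: filterS => y xy; apply: (le_trans (fL x y)).
apply: (@le_trans _ _ (C * (e / (C + 1)))); first by rewrite ler_wpM2l.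
by rewrite mulrCA ler_piMr ?(ltW e0)// ler_pdivrMr// mul1r; lra.
Qed.

Lemma continuous_bounded_outside f (M : R) : continuous f ->
  (forall x, 1 <= `|x| -> `|f x| <= M) -> exists C, forall x, `|f x| <= C.
Proof.
move=> cf fM.
have [] := @EVT_max R (fun x => `|f x|) (-1) 1.
- by lra.
- apply: continuous_subspaceT => x.
  by apply: (@continuous_comp _ _ _ f (fun z : R => `|z|)); [exact: cf|exact: norm_continuous].
- move=> c _ fc; exists (Num.max M `|f c|) => x.
  rewrite le_max; have [/fM->//|x1] := leP 1 `|x|.
  by rewrite fc ?orbT// in_itv/= -ler_norml ltW.
Qed.

End real_derivatives.

(** * Gaussian tail estimates *)

Section stein_equation.
Context {R : realType}.
Implicit Types f g h r : R -> R.

Local Notation phi := (@normal_pdf R 0 1).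

Lemma std_normal_pdfE x : phi x = normal_peak 1 * expR (- x ^+ 2 / 2).
Proof. by rewrite normal_pdfE// /normal_fun subr0 expr1n. Qed.

Lemma std_normal_pdf_gt0 x : 0 < phi x.
Proof. by rewrite std_normal_pdfE mulr_gt0 ?expR_gt0 ?normal_peak_gt0. Qed.

Lemma std_normal_pdfN x : phi (- x) = phi x.
Proof. by rewrite !std_normal_pdfE sqrrN. Qed.

Lemma is_derive_std_normal_pdf (x : R) : is_derive x 1 phi (- (x * phi x)).
Proof.
have -> : phi = (fun x => normal_peak 1 * expR (x * x * (- 1 / 2))).
  by apply/funext => y; rewrite std_normal_pdfE; congr (_ * expR _); field.
have idx : is_derive x 1 (fun y : R => y) 1 by exact: is_derive_id.
have dsq := is_derive_mulf (is_derive_mulf idx idx) (is_derive_cstf (- 1 / 2) x).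
have de := is_derive_compf dsq (is_derive_expR _).
have := is_derive_mulf (is_derive_cstf (normal_peak 1) x) de.
by move/is_derive_eq; apply; field.
Qed.

Definition vanishes f := forall e, 0 < e -> exists A, forall x, A <= `|x| -> `|f x| <= e.

Lemma vanishes_std_normal_pdf : vanishes phi.
Proof.
(* For [1 <= |x|], [expR (x ^+ 2 / 2)] is at least [|x| / 2], so the density is at most
   [2 * normal_peak 1 / |x|]. *)
move=> e e0; exists (Num.max 1 (2 * normal_peak 1 / e)) => x.
rewrite ge_max => /andP[x1 xA].
rewrite gtr0_norm ?std_normal_pdf_gt0// std_normal_pdfE mulNr expRN.
have x0 : 0 < `|x| by rewrite (lt_le_trans _ x1).
have E1 : `|x| / 2 <= expR (x ^+ 2 / 2).
  apply: le_trans (expR_ge1Dx _).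
  have : `|x| <= x ^+ 2 by rewrite -(ger0_norm (sqr_ge0 x)) normrX expr2 ler_peMr.
  lra.
rewrite ler_pdivrMr ?expR_gt0//.
apply: (@le_trans _ _ (e * (`|x| / 2))); last by rewrite ler_wpM2l// ltW.
move: xA; rewrite ler_pdivrMr//; lra.
Qed.

Lemma vanishes_mul g f : (exists C, forall x, `|g x| <= C) -> vanishes f ->
  vanishes (fun x => g x * f x).
Proof.
move=> [C gC] vf e e0.
have C0 : 0 <= C by apply: le_trans (gC 0).
have [|A fA] := vf (e / (C + 1)); first by rewrite divr_gt0// ltr_wpDl.
exists A => x /fA fx; rewrite normrM.
apply: (@le_trans _ _ (C * (e / (C + 1)))); first by rewrite ler_pM.
have C10 : 0 < C + 1 by rewrite ltr_wpDl.
by rewrite mulrCA ler_piMr ?ltW// ltr_pdivrMr// mul1r; lra.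
Qed.

(* Comparison with [(g y + M / x) phi y], whose derivative is nonpositive for
   [x <= y]. *)
Lemma tail_lower_bound g r (M : R) :
  (forall x : R, is_derive x 1 (fun y => g y * phi y) (r x * phi x)) ->
  (forall x, `|r x| <= M) -> vanishes (fun y => g y * phi y) ->
  forall x, 0 < x -> - M <= x * g x.
Proof.
move=> dg rM vg x x0.
have M0 : 0 <= M by apply: le_trans (rM 0).
pose k y := x * (g y * phi y) + M * phi y.
have dk (y : R) : is_derive y 1 k (x * (r y * phi y) + M * - (y * phi y)).
  have := is_derive_addf (is_derive_mulf (is_derive_cstf x y) (dg y))
    (is_derive_mulf (is_derive_cstf M y) (is_derive_std_normal_pdf y)).
  by move/is_derive_eq; apply; ring.
suff : 0 <= k x.
  rewrite /k mulrA -mulrDl pmulr_lge0 ?std_normal_pdf_gt0//; lra.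
apply/ler_addgt0Pr => e e0.
have [|A vA] := vg (e / x); first by rewrite divr_gt0.
pose y := Num.max x `|A|.
have xy : x <= y by rewrite le_max lexx.
have Ay : A <= `|y|.
  by rewrite (le_trans (ler_norm A))// (le_trans _ (ler_norm y))// le_max lexx orbT.
have [c /andP[xc cy] E] := mean_value dk xy.
have kyx : k y <= k x.
  rewrite -subr_le0 E mulr_le0_ge0 ?subr_ge0//.
  have := ler_norm (r c); have := rM c => r1 r2.
  have rc : x * r c <= M * c.
    apply: (@le_trans _ _ (x * M)); first by rewrite ler_wpM2l ?(ltW x0)// (le_trans r2).
    by rewrite mulrC ler_wpM2l.
  rewrite (_ : _ + _ = (x * r c - M * c) * phi c); last by ring.
  by rewrite mulr_le0_ge0 ?subr_le0// normal_pdf_ge0.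
have : - e <= k y.
  rewrite /k -[leLHS]addr0 lerD//; last by rewrite mulr_ge0// normal_pdf_ge0.
  have := vA y Ay; rewrite ler_norml => /andP[+ _].
  by rewrite lerNl ler_pdivlMr// mulNr lerNl mulrC.
lra.
Qed.

(** A Mills ratio estimate. The one-sided bound for positive [x] is applied to [g] and [- g], and
    negative [x] are reached by reflection, the density being even. *)
Lemma tail_bound g r (M : R) :
  (forall x : R, is_derive x 1 (fun y => g y * phi y) (r x * phi x)) ->
  (forall x, `|r x| <= M) -> vanishes (fun y => g y * phi y) ->
  forall x, `|x * g x| <= M.
Proof.
have pos g1 r1 : (forall x : R, is_derive x 1 (fun y => g1 y * phi y) (r1 x * phi x)) ->
  (forall x, `|r1 x| <= M) -> vanishes (fun y => g1 y * phi y) ->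
  forall x, 0 < x -> `|x * g1 x| <= M.
  move=> dg rM vg x x0; rewrite ler_norml (tail_lower_bound dg rM vg)//=.
  rewrite -[leLHS]opprK lerNl -mulrN.
  apply: (@tail_lower_bound (fun y => - g1 y) (fun y => - r1 y) M) => //.
  - move=> y; have := is_derive_mulf (is_derive_cstf (-1) y) (dg y).
    rewrite (_ : (fun _ => _) = (fun y => - g1 y * phi y)).
      by move/is_derive_eq; apply; ring.
    by apply/funext => z; rewrite mulN1r mulNr.
  - by move=> y; rewrite normrN.
  - by move=> e /vg[A vA]; exists A => y /vA; rewrite mulNr normrN.
move=> dg rM vg x.
have M0 : 0 <= M by apply: le_trans (rM 0).
have [x0|x0|<-] := ltgtP 0 x; last by rewrite mul0r normr0.
  exact: pos dg rM vg _ x0.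
rewrite -normrN -mulNr -[in g x](opprK x).
apply: (pos (fun y => g (- y)) (fun y => - r (- y))).
- move=> y; have idx : is_derive y 1 (fun y : R => - y) (-1) by exact: is_deriveNid.
  have := is_derive_compf idx (dg (- y)).
  rewrite (_ : (fun _ => _) = (fun y => g (- y) * phi y)).
    by move/is_derive_eq; apply; rewrite std_normal_pdfN; ring.
  by apply/funext => z; rewrite std_normal_pdfN.
- by move=> y; rewrite normrN.
- move=> e /vg[A vA]; exists A => y Ay.
  by have := vA (- y); rewrite normrN std_normal_pdfN; apply.
- by rewrite oppr_gt0.
Qed.

(** In the derivative of [g * phi] the terms in [x * g x] cancel, leaving [r * phi], so [tail_bound]
    applies. It serves twice: for the solution of Stein's equation and for its derivative, which
    solves an equation of the same form. *)
Lemma gaussian_mul_bounded g dg r (M : R) :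
  (forall x : R, is_derive x 1 g (dg x)) ->
  (forall x, dg x = x * g x + r x) ->
  (forall x, `|r x| <= M) -> vanishes (fun y => g y * phi y) ->
  (exists C, forall x, `|g x| <= C) /\ (forall x, `|dg x| <= M + M).
Proof.
move=> g' dgE rM vg.
have dgphi (x : R) : is_derive x 1 (fun y => g y * phi y) (r x * phi x).
  have := is_derive_mulf (g' x) (is_derive_std_normal_pdf x).
  by move/is_derive_eq; apply; rewrite dgE; ring.
have xg := tail_bound dgphi rM vg; split.
  apply: (@continuous_bounded_outside _ g M) => [|x x1].
    exact: is_derive_continuous g'.
  by apply: le_trans (xg x); rewrite normrM ler_peMl.
by move=> x; rewrite dgE (le_trans (ler_normD _ _))// lerD.
Qed.

End stein_equation.

(** * Solutions of Stein's equation with bounded derivatives *)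

Section stein_solution.
Context {R : realType}.
Local Notation phi := (@normal_pdf R 0 1).
Local Notation mu := (@lebesgue_measure R).
Local Notation gam := (@normal_prob R 0 1).

Lemma integrable_mul_std_normal_pdf (h : R -> R) C : measurable_fun setT h ->
  (forall x, `|h x| <= C) -> mu.-integrable setT (EFin \o (fun x => h x * phi x)).
Proof.
move=> mh hC.
have C0 : 0 <= C by apply: le_trans (hC 0).
apply: (@le_integrable _ _ _ mu setT measurableT _ (fun x => C%:E * (phi x)%:E)%E).
- by apply/measurable_EFinP; apply: measurable_funM => //; exact: measurable_normal_pdf.
- move=> x _ /=; rewrite lee_fin !normrM ler_wpM2r//.
  by rewrite (le_trans (hC x))// ler_norm.
- exact/integrableZl/integrable_normal_pdf.
Qed.

Lemma normal_prob_fine (A : set R) : \int[mu]_(x in A) phi x = fine (gam A).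
Proof. by []. Qed.

Lemma Rintegral_std_normal_pdf : \int[mu]_x phi x = 1.
Proof. by rewrite /Rintegral integral_normal_pdf. Qed.

(** Read off from the limits of the distribution function of the identity, seen as a random variable
    under [gam]. *)
Lemma normal_prob_tails e : 0 < e -> exists A, forall x,
  (x <= - A -> fine (gam `]-oo, x]) <= e) /\
  (A <= x -> fine (gam `]x, +oo[) <= e).
Proof.
move=> e0.
have mid : measurable_fun setT (idfun : measurableTypeR R -> R) by exact: measurable_id.
pose X : {RV gam >-> R} :=
  HB.pack (idfun : measurableTypeR R -> R) (isMeasurableFun.Build _ _ _ _ _ mid).
have /fine_cvg/cvgrPdist_le/(_ e e0) := @cvg_cdfNy0 _ _ _ gam X.
move=> [a [_ ha]].
have /fine_cvg/cvgrPdist_le/(_ e e0) := @cvg_ccdfy0 _ _ _ gam X.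
move=> [b [_ hb]].
exists (`|a| + `|b| + 1) => x; split => xA.
- have /ha : x < a by have := ler_norm (- a); rewrite normrN; have := normr_ge0 b; lra.
  by rewrite /= sub0r normrN; apply: le_trans; exact: ler_norm.
- have /hb : b < x by have := ler_norm b; have := normr_ge0 a; lra.
  by rewrite /= sub0r normrN; apply: le_trans; exact: ler_norm.
Qed.

Lemma stein_solution (h dh : R -> R) (L : R) :
  (forall x : R, is_derive x 1 h (dh x)) -> (forall x, `|dh x| <= L) ->
  (forall x, 0 <= h x <= 1) ->
  exists f df C, [/\ forall x : R, is_derive x 1 f (df x),
    forall x, df x - x * f x = h x - \int[mu]_x (h x * phi x),
    (forall x, `|f x| <= C), (forall x, `|df x| <= C) &
    forall x y, `|df x - df y| <= C * `|x - y| ].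
Proof.
move=> dhE dhL h01; set c := \int[mu]_x _.
have ch : continuous h by exact: is_derive_continuous dhE.
have mh : measurable_fun setT h by exact: continuous_measurable_fun.
have ih : mu.-integrable setT (EFin \o (fun x => h x * phi x)).
  apply: (@integrable_mul_std_normal_pdf h 1) => // x.
  by have /andP[? ?] := h01 x; rewrite ger0_norm.
have c01 : 0 <= c <= 1.
  apply/andP; split.
    apply: Rintegral_ge0 => x _; rewrite mulr_ge0 ?normal_pdf_ge0//.
    by have /andP[] := h01 x.
  rewrite -Rintegral_std_normal_pdf; apply: le_Rintegral => //.
    exact: integrable_normal_pdf.
  move=> x _; rewrite ler_piMl ?normal_pdf_ge0//.
  by have /andP[] := h01 x.
pose r x := h x - c.
have r1 x : `|r x| <= 1.
  by rewrite ler_norml /r; have /andP[] := h01 x; have /andP[] := c01; lra.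
have cr : continuous r by move=> x; apply: cvgB; [exact: ch|exact: cvg_cst].
have mr : measurable_fun setT r by exact: continuous_measurable_fun.
have ir : mu.-integrable setT (EFin \o (fun x => r x * phi x)).
  exact: (@integrable_mul_std_normal_pdf r 1).
have irA (A : set R) : measurable A -> mu.-integrable A (EFin \o (fun x => r x * phi x)).
  by move=> mA; apply: integrableS ir.
have ipA (A : set R) : measurable A -> mu.-integrable A (EFin \o phi).
  by move=> mA; apply: integrableS (integrable_normal_pdf 0 1).
(* [F / phi] is the classical solution: the derivative of [1 / phi] is [x / phi], which produces the
   term [x * f x]. *)
pose F x := \int[mu]_(t in `]-oo, x]) (r t * phi t).
have dF (x : R) : is_derive x 1 F (r x * phi x).
  have crp : {for x, continuous (fun x => r x * phi x)}.
    by apply: cvgM; [exact: cr|exact: continuous_normal_pdf].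
  have [|//||dF FE] := @continuous_FTC1 R (fun t => r t * phi t)
    (BInfty R true) x (x + 1) _ _ _ crp.
  - by rewrite ltrDl.
  - exact: irA.
  - by rewrite ltNye_eq.
  - by apply: DeriveDef => //; rewrite -derive1E.
have boundF (A : set R) : measurable A ->
    `|\int[mu]_(t in A) (r t * phi t)| <= fine (gam A).
  move=> mA; apply: (@le_trans _ _ (\int[mu]_(t in A) `|r t * phi t|)).
    exact: le_normr_Rintegral (irA _ mA).
  rewrite -normal_prob_fine; apply: le_Rintegral => //.
  - by apply: integrable_norm; exact: irA.
  - exact: ipA.
  - move=> x _; rewrite normrM (ger0_norm (normal_pdf_ge0 _ _ _)).
    by rewrite ler_piMl ?normal_pdf_ge0.
have F0 : \int[mu]_t (r t * phi t) = 0.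
  rewrite (_ : (fun t => _) = (fun t => h t * phi t - c * phi t)); last first.
    by apply/funext => t; rewrite mulrBl.
  rewrite RintegralB//; last first.
    exact: (@integrable_mul_std_normal_pdf (fun=> c) `|c|).
  rewrite RintegralZl//; last exact: integrable_normal_pdf.
  by rewrite Rintegral_std_normal_pdf mulr1 subrr.
(* Centering [h] makes the total integral zero, so [F] is also minus the right tail; this is what
   makes it decay at plus infinity. *)
have FC x : F x = - \int[mu]_(t in `]x, +oo[) (r t * phi t).
  have UT : `]-oo, x] `|` `]x, +oo[ = [set: R] by rewrite -setCitvl setUv.
  apply/eqP; rewrite -addr_eq0 -Rintegral_setU//.
  - by rewrite UT F0.
  - by rewrite UT.
  - by rewrite -setCitvl; apply/disj_setPCl.
pose psi x := (phi x)^-1.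
have dpsi (x : R) : is_derive x 1 psi (x * psi x).
  have := is_deriveV (lt0r_neq0 (std_normal_pdf_gt0 x)) (is_derive_std_normal_pdf x).
  move/is_derive_eq; apply; rewrite /psi /GRing.scale/=; field.
  by rewrite lt0r_neq0// std_normal_pdf_gt0.
have phiV x : psi x * phi x = 1 by rewrite mulVf// lt0r_neq0// std_normal_pdf_gt0.
pose f x := F x * psi x.
pose df x := x * f x + r x.
have df' (x : R) : is_derive x 1 f (df x).
  have := is_derive_mulf (dF x) (dpsi x).
  move/is_derive_eq; apply.
  by rewrite /df /f -mulrA (mulrC (phi x)) phiV; ring.
have vF : vanishes (fun y => f y * phi y).
  move=> e e0; have [A hA] := normal_prob_tails e0; exists (Num.max A 0) => x.
  rewrite ge_max => /andP[Ax _].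
  rewrite /f -mulrA phiV mulr1.
  have [x0|x0] := leP 0 x.
    rewrite FC normrN (le_trans (boundF _ _))//.
    by apply: (hA x).2; rewrite ger0_norm in Ax.
  rewrite (le_trans (boundF _ _))//.
  by apply: (hA x).1; rewrite ltr0_norm in Ax => //; rewrite lerNr.
have [[C fC] df2] := gaussian_mul_bounded df' (fun=> erefl) r1 vF.
(* Differentiating Stein's equation gives the same equation for [df] with source [f + dh], bounded
   by [C + L]; the resulting bound on the second derivative is the Lipschitz constant of [df]. *)
pose ddf x := x * df x + (f x + dh x).
have ddf' (x : R) : is_derive x 1 df (ddf x).
  have idx : is_derive x 1 (fun y : R => y) 1 by exact: is_derive_id.
  have := is_derive_addf (is_derive_mulf idx (df' x))
            (is_derive_addf (dhE x) (is_derive_cstf (- c) x)).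
  by move/is_derive_eq; apply; rewrite /ddf; ring.
have fdhC x : `|f x + dh x| <= C + L by rewrite (le_trans (ler_normD _ _))// lerD.
have vdf : vanishes (fun y => df y * phi y).
  by apply: vanishes_mul vanishes_std_normal_pdf; exists 2 => x; apply: df2.
have [_ ddfC] := gaussian_mul_bounded ddf' (fun=> erefl) fdhC vdf.
(* One constant for three bounds: [C] for [f], [1 + 1] for [df] and [2 * (C + L)] for the Lipschitz
   constant. *)
exists f, df, (`|C| + 2 + `|C + L + (C + L)|); split => //.
- by move=> x; rewrite /df /r; ring.
- by move=> x; rewrite (le_trans (fC x))// (le_trans (ler_norm C))// -addrA lerDl addr_ge0.
- move=> x; rewrite (le_trans (df2 x))//.
  by have := normr_ge0 C; have := normr_ge0 (C + L + (C + L)); lra.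
- apply: lipschitz_of_derive ddf' _ => x; rewrite (le_trans (ddfC x))//.
  by rewrite (le_trans (ler_norm _))// lerDr addr_ge0.
Qed.

End stein_solution.

(** * From Stein's equation to distribution functions *)

Section stein_clt.
Context {R : realType}.
Local Notation phi := (@normal_pdf R 0 1).
Local Notation mu := (@lebesgue_measure R).
Local Notation gam := (@normal_prob R 0 1).

(** The double exponential [expR (- expR (k * (x - s - eta / 2)))] is a smooth step in closed form,
    so no pieces are glued; its slope is at most [k] because [t * expR (- t) <= 1]. *)
Lemma smooth_step (s eta del : R) : 0 < eta -> 0 < del ->
  exists (h dh : R -> R) (L : R), [/\ forall x : R, is_derive x 1 h (dh x),
    forall x, `|dh x| <= L, forall x, 0 <= h x <= 1,
    forall x, (x <= s)%R%:R <= h x + del &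
    forall x, h x <= (x <= s + eta)%R%:R + del].
Proof.
move=> eta0 del0.
(* With [k * (eta / 2) = 1 / del], the inner exponential is at most [expR (- 1 / del) <= del] left
   of [s] and at least [1 / del] right of [s + eta], so [h] is within [del] of 1 and of 0 there. *)
pose k := (eta / 2 * del)^-1; have k0 : 0 < k by rewrite invr_gt0 mulr_gt0// divr_gt0.
have keta : k * (eta / 2) = del^-1 by rewrite /k; field; rewrite !lt0r_neq0.
have Edel : del^-1 <= expR del^-1 by apply: le_trans (expR_ge1Dx _); rewrite lerDr.
have ENdel : expR (- del^-1) <= del.
  by rewrite expRN -[leRHS]invrK lef_pV2// posrE ?expR_gt0 ?invr_gt0.
pose e x := expR ((x - (s + eta / 2)) * k).
pose h x := expR (e x * (-1)).
exists h, (fun x => h x * (e x * k * -1)), k; split.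
- move=> x; have idx : is_derive x 1 (fun y : R => y) 1 by exact: is_derive_id.
  have d1 := is_derive_mulf (is_derive_addf idx (is_derive_cstf (- (s + eta / 2)) x))
    (is_derive_cstf k x).
  have d2 := is_derive_mulf (is_derive_compf d1 (is_derive_expR _)) (is_derive_cstf (- 1) x).
  have := is_derive_compf d2 (is_derive_expR _).
  by move/is_derive_eq; apply; rewrite /h /e; ring.
- move=> x; rewrite mulrN1 mulrN normrN ger0_norm; last first.
    by rewrite !mulr_ge0 ?expR_ge0// ltW.
  rewrite mulrA ler_piMl ?(ltW k0)// /h mulrN1 expRN mulrC ler_pdivrMr ?expR_gt0// mul1r.
  by apply: le_trans (expR_ge1Dx _); rewrite lerDr.
- move=> x; rewrite expR_ge0/= -[leRHS]expR0 ler_expR mulrN1 oppr_le0.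
  exact: expR_ge0.
- move=> x; have [xs|sx] := leP x s; last by rewrite addr_ge0 ?expR_ge0// ltW.
  have ex : e x <= del.
    apply: le_trans ENdel; rewrite ler_expR -keta [k * _]mulrC -mulNr ler_wpM2r ?(ltW k0)//.
    by lra.
  rewrite -lerBlDr; apply: le_trans (expR_ge1Dx _); rewrite mulrN1/=; lra.
- move=> x; have [xs|sx] := leP x (s + eta).
    rewrite -[leLHS]addr0 lerD ?(ltW del0)// -[leRHS]expR0 ler_expR mulrN1 oppr_le0.
    exact: expR_ge0.
  rewrite add0r; apply: le_trans ENdel; rewrite ler_expR mulrN1 lerN2.
  apply: le_trans Edel _; rewrite ler_expR -keta mulrC ler_wpM2r ?(ltW k0)//.
  by lra.
Qed.

Lemma gaussian_step (h : R -> R) s s' del : measurable_fun setT h ->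
  (forall x, 0 <= h x <= 1) ->
  (forall x, (x <= s)%R%:R <= h x + del) ->
  (forall x, h x <= (x <= s')%R%:R + del) ->
  fine (gam `]-oo, s]) - del <= \int[mu]_x (h x * phi x) <=
    fine (gam `]-oo, s']) + del.
Proof.
move=> mh h01 hs hs'.
have ih : mu.-integrable setT (EFin \o (fun x => h x * phi x)).
  apply: (@integrable_mul_std_normal_pdf _ h 1) => // x.
  by have /andP[? ?] := h01 x; rewrite ger0_norm.
have ii a : mu.-integrable setT (EFin \o (fun x => \1_(`]-oo, a] : set R) x * phi x)).
  apply: (@integrable_mul_std_normal_pdf _ _ 1) => //.
  by move=> x; rewrite indicE; case: (_ \in _); rewrite ?normr1 ?normr0.
have ic : mu.-integrable setT (EFin \o (fun x => del * phi x)).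
  exact: (@integrable_mul_std_normal_pdf _ (fun=> del) `|del|).
have PhiE a : fine (gam `]-oo, a]) = \int[mu]_x (\1_(`]-oo, a] : set R) x * phi x).
  rewrite -normal_prob_fine Rintegral_mkcond; apply: eq_Rintegral => x _.
  by rewrite patchE indicE; case: (_ \in _); rewrite ?mul1r ?mul0r.
have delE : \int[mu]_x (del * phi x) = del.
  by rewrite RintegralZl//; [rewrite Rintegral_std_normal_pdf mulr1|exact: integrable_normal_pdf].
have indE a x : \1_(`]-oo, a] : set R) x = (x <= a)%R%:R :> R.
  by rewrite indicE; congr (nat_of_bool _)%:R; apply/idP/idP; rewrite inE/= in_itv.
have iD (f g : R -> R) : mu.-integrable setT (EFin \o f) ->
    mu.-integrable setT (EFin \o g) -> mu.-integrable setT (EFin \o (fun x => f x + g x)).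
  move=> fi gi; rewrite (_ : _ \o _ = ((EFin \o f) \+ (EFin \o g))%E); last by apply/funext.
  exact: integrableD.
rewrite !PhiE -delE lerBlDr -!RintegralD//; apply/andP; split; apply: le_Rintegral => //;
  try exact: iD;
  by move=> x _; rewrite -mulrDl ler_wpM2r ?normal_pdf_ge0// indE.
Qed.

(** The shift by [eta] is the width of the smooth step; it is kept in the conclusion and absorbed
    only when convergence in distribution is derived. *)
Lemma cdf_near_normal (d : nat -> measure_display)
    (T : forall G, measurableType (d G)) (P : forall G, probability (T G) R)
    (W : forall G, T G -> R) :
  (forall G, bounded_mfun (W G)) ->
  (forall (f df : R -> R) (C : R), (forall x : R, is_derive x 1 f (df x)) ->
    (forall x, `|f x| <= C) -> (forall x, `|df x| <= C) ->
    (forall x y, `|df x - df y| <= C * `|x - y|) ->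
    expect (P G) (fun w => df (W G w) - W G w * f (W G w)) @[G --> \oo] --> 0) ->
  forall s eta del, 0 < eta -> 0 < del -> \forall G \near \oo,
    fine (P G [set w | W G w <= s]) <= fine (gam `]-oo, s + eta]) + del /\
    fine (gam `]-oo, s]) - del <= fine (P G [set w | W G w <= s + eta]).
Proof.
move=> bW stein s eta del eta0 del0.
(* One third each for replacing the indicator by [h] under [W], for the Stein expectation, and for
   the same replacement under the normal law. *)
have del30 : 0 < del / 3 by rewrite divr_gt0.
have [h [dh [L [h' dhL h01 hs hs']]]] := smooth_step s eta0 del30.
have mh : measurable_fun setT h.
  by apply: continuous_measurable_fun; exact: is_derive_continuous h'.
have /andP[lo up] := gaussian_step mh h01 hs hs'.
have [f [df [C [f' dfE fC dfC dfL]]]] := stein_solution h' dhL h01.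
have /cvgrPdist_le/(_ _ del30) := stein f df C f' fC dfC dfL.
apply: filterS => G; rewrite sub0r normrN.
have bhW : bounded_mfun (fun w => h (W G w)).
  apply: bounded_mfun_comp => //; first exact: is_derive_continuous h'.
  by exists 1 => x; have /andP[? ?] := h01 x; rewrite ger0_norm.
rewrite (_ : (fun w => _) = (fun w => h (W G w) - \int[mu]_x (h x * phi x))); last first.
  by apply/funext => w; exact: dfE.
rewrite expectB ?expect_cst//; last exact: bounded_mfun_cst.
rewrite ler_norml => /andP[lo' up'].
have mA a : measurable [set w | W G w <= a].
  rewrite [X in measurable X](_ : _ = setT `&` W G @^-1` `]-oo, a]); last first.
    by apply/seteqP; split => w /=; rewrite in_itv/=; [split|case].
  by have [mW _] := bW G; exact: mW.
have indE a w : \1_[set w | W G w <= a] w = (W G w <= a)%R%:R :> R.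
  by rewrite indicE; congr (nat_of_bool _)%:R; apply/idP/idP; rewrite inE.
split.
- have : fine (P G [set w | W G w <= s]) <= expect (P G) (fun w => h (W G w)) + del / 3.
    rewrite -expect_indic// -[X in _ + X](expect_cst (P G)) -expectD//;
      last exact: bounded_mfun_cst.
    apply: le_expect; first exact: bounded_mfun_indic.
      by apply: bounded_mfunD => //; exact: bounded_mfun_cst.
    by move=> w; rewrite indE.
  lra.
- have : expect (P G) (fun w => h (W G w)) <= fine (P G [set w | W G w <= s + eta]) + del / 3.
    rewrite -expect_indic// -[X in _ + X](expect_cst (P G)) -expectD//; last 2 first.
    - exact: bounded_mfun_indic.
    - exact: bounded_mfun_cst.
    apply: le_expect => //.
      by apply: bounded_mfunD; [exact: bounded_mfun_indic|exact: bounded_mfun_cst].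
    by move=> w; rewrite indE.
  lra.
Qed.

End stein_clt.

(** * Dyads *)

Section dyad_counting.
Variables (G N : nat) (psi : 'I_N -> {set 'I_G}).
Hypothesis dyads : dyad_enumeration psi.

Lemma share_unitC n m : share_unit psi n m = share_unit psi m n.
Proof. by rewrite /share_unit disjoint_sym. Qed.

Lemma share_unit_refl n : share_unit psi n n.
Proof.
by rewrite /share_unit -setI_eq0 finset.setIid -cards_eq0 dyads.2.
Qed.

(** An intersection with two elements would equal both dyads, which injectivity of [psi] rules out
    for distinct indices. *)
Lemma card_common_units n m :
  #|psi n :&: psi m| = (share_unit psi n m + (n == m))%N.
Proof.
have [inj c2] := dyads.
have [<-|nm] := eqVneq n m; first by rewrite finset.setIid c2 share_unit_refl.
rewrite addn0 /share_unit -setI_eq0 -cards_eq0.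
suff : (#|psi n :&: psi m| < 2)%N by case: #|_| => [|[|]].
rewrite ltnNge; apply: contra_neqN nm => c2'; apply: inj.
have sn : psi n :&: psi m = psi n.
  by apply/eqP; rewrite eqEcard finset.subsetIl c2.
have sm : psi n :&: psi m = psi m.
  by apply/eqP; rewrite eqEcard finset.subsetIr c2.
by rewrite -sn sm.
Qed.

(** On the right [m] occurs once per unit shared with [n]: once for another neighbour and twice for
    [n] itself, whence the extra [z n]. Over a semiring it covers both random terms and, with
    [z = 1] in [nat], the counting of neighbours. *)
Lemma sum_common_units (R : pzSemiRingType) n (z : 'I_N -> R) :
  \sum_(m | share_unit psi n m) z m + z n =
  \sum_(g in psi n) \sum_(m | g \in psi m) z m.
Proof.
rewrite (exchange_big_dep predT)//=.
rewrite [in LHS]big_mkcond [z n in LHS](_ : _ = \sum_m (n == m)%:R * z m); last first.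
  rewrite (bigD1 n)//= eqxx mul1r big1 ?addr0// => m /negPf.
  by rewrite eq_sym => ->; rewrite mul0r.
rewrite -big_split/=; apply: eq_bigr => m _.
rewrite sumr_const -[in RHS]mulr_natl (_ : #|_| = #|psi n :&: psi m|); last first.
  by apply: eq_card => g; rewrite !inE.
by rewrite card_common_units natrD mulrDl; case: share_unit; rewrite ?mul1r ?mul0r.
Qed.

Lemma card_share_unit n :
  (#|[pred m | share_unit psi n m]| <= 2 * max_dyads_of psi)%N.
Proof.
have E : (#|[pred m | share_unit psi n m]| + 1 =
    \sum_(g in psi n) \sum_(m | g \in psi m) 1)%N.
  by rewrite -sum1_card; exact: (@sum_common_units nat n (fun=> 1%N)).
apply: (@leq_trans (\sum_(g in psi n) \sum_(m | g \in psi m) 1)%N).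
  by rewrite -E leq_addr.
rewrite -(dyads.2 n) -sum_nat_const; apply: leq_sum => g _.
by rewrite sum1_card; apply: (@leq_bigmax _ (fun g => dyads_of psi g)).
Qed.

Lemma sum_share_unit_le (R : realType) n (Delta : R) : (max_dyads_of psi)%:R <= Delta ->
  \sum_m (share_unit psi n m)%:R <= 2 * Delta.
Proof.
move=> MD; apply: (@le_trans _ _ (2 * (max_dyads_of psi)%:R)); last by rewrite ler_wpM2l.
rewrite -natrM -natr_sum ler_nat; apply: leq_trans (card_share_unit n).
by rewrite -sum1_card [leqRHS]big_mkcond/=; apply: leq_sum => m _; rewrite inE; case: share_unit.
Qed.

(** Sending a dyad that contains [g] to its other unit is injective. *)
Lemma dyads_of_le g : (dyads_of psi g <= G)%N.
Proof.
have [inj c2] := dyads.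
rewrite /dyads_of -[leqRHS]card_ord.
have other n : g \in psi n -> exists h, psi n = [set g; h]%SET.
  move=> gn; have : #|psi n :\ g| = 1%N by have := cardsD1 g (psi n); rewrite gn c2 => -[].
  by move=> /eqP/cards1P[h hE]; exists h; rewrite -hE finset.setD1K.
pose f n : 'I_G := odflt g [pick h | psi n == [set g; h]]%SET.
have fE n : g \in psi n -> psi n = [set g; f n]%SET.
  move=> /other[h hE]; rewrite /f; case: pickP => [h' /eqP//|/(_ h)].
  by rewrite hE eqxx.
rewrite -(@card_in_imset _ _ f); first exact: max_card.
by move=> n m; rewrite !inE => gn gm fnm; apply: inj; rewrite (fE n)// (fE m)// fnm.
Qed.

Lemma sum_dyads_of : (\sum_g dyads_of psi g = 2 * N)%N.
Proof.
under eq_bigr do rewrite /dyads_of -sum1_card.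
rewrite (exchange_big_dep predT)//=.
under eq_bigr => n _ do rewrite sum1_card (_ : #|_| = #|psi n|) ?dyads.2//.
by rewrite sum_nat_const card_ord mulnC.
Qed.

Lemma min_dyads_of_le g : (min_dyads_of psi <= dyads_of psi g)%N.
Proof.
have : g \in index_enum 'I_G by rewrite mem_index_enum.
rewrite /min_dyads_of; elim: (index_enum _) => // a s ih.
rewrite big_cons inE => /predU1P[->|/ih]; first exact: geq_minl.
exact: leq_trans (geq_minr _ _).
Qed.

End dyad_counting.

(** * Variances under local dependence *)

Section local_dependence.
Context (R : realType) d (T : measurableType d) (P : probability T R).
Variables (G N : nat) (psi : 'I_N -> {set 'I_G}).
Hypothesis dyads : dyad_enumeration psi.
Context d' (T' : measurableType d').
Variable V : 'I_N -> T -> T'.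
Hypothesis mV : forall n, measurable_fun setT (V n).
Hypothesis indep : forall S1 S2 : {set 'I_N},
  (forall n m, n \in S1 -> m \in S2 -> ~~ share_unit psi n m) ->
  independent_subfamilies P V S1 S2.
Local Notation E := (expect P).
Local Notation s := (share_unit psi).

(** Expanding the square leaves only connected pairs, each worth at most [(C + C) ^+ 2] because
    centering doubles the bound. The index type is free so that single dyads and pairs of dyads are
    both covered. *)
Lemma variance_sum_le (J : finType) (p : pred J) (supp : J -> {set 'I_N})
    (X : J -> T -> R) (C : R) (conn : rel J) :
  (forall j, known V (supp j) (X j)) -> (forall j w, `|X j w| <= C) ->
  (forall j k, ~~ conn j k ->
    forall n m, n \in supp j -> m \in supp k -> ~~ s n m) ->
  E (fun w => (\sum_(j | p j) X j w - \sum_(j | p j) E (X j)) ^+ 2) <=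
  (C + C) ^+ 2 * \sum_(j | p j) \sum_(k | p k) (conn j k)%:R.
Proof.
move=> kX XC nconn.
have bX j : bounded_mfun (X j) by exact: known_bounded_mfun (kX j).
pose Y j w := X j w - E (X j).
have kY j : known V (supp j) (Y j).
  by apply: bounded_mfunD; [exact: kX|exact: bounded_mfun_cst].
have bY j : bounded_mfun (Y j) by exact: known_bounded_mfun (kY j).
have EY j : E (Y j) = 0.
  by rewrite expectB ?expect_cst ?subrr//; exact: bounded_mfun_cst.
have YC j w : `|Y j w| <= C + C.
  by rewrite (le_trans (ler_normB _ _))// lerD// expect_bound.
have -> : (fun w => (\sum_(j | p j) X j w - \sum_(j | p j) E (X j)) ^+ 2) =
    (fun w => \sum_(j | p j) \sum_(k | p k) Y j w * Y k w).
  apply/funext => w; rewrite -sumrB expr2 big_distrl/=.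
  by apply: eq_bigr => j _; rewrite big_distrr.
rewrite expect_sum; last by move=> j; bounded_mfun_tac.
rewrite big_distrr/=; apply: ler_sum => j _.
rewrite expect_sum; last by move=> k; bounded_mfun_tac.
rewrite big_distrr/=; apply: ler_sum => k _.
have [jk|/nconn jk] := boolP (conn j k).
  rewrite mulr1 (le_trans (ler_norm _))// expect_bound//.
    by bounded_mfun_tac.
  by move=> w; rewrite normrM expr2 ler_pM.
by rewrite mulr0 (expectM_known mV (indep jk) (kY j) (kY k)) EY mul0r.
Qed.

Variable Delta : R.
Hypothesis degree : forall n, \sum_m (s n m)%:R <= Delta.

Lemma degree_ge0 (n : 'I_N) : 0 <= Delta.
Proof. by apply: le_trans (degree n); rewrite sumr_ge0. Qed.

Lemma variance_sum1_le (X : 'I_N -> T -> R) (C : R) :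
  (forall n, known V [set n]%SET (X n)) -> (forall n w, `|X n w| <= C) ->
  E (fun w => (\sum_n X n w - \sum_n E (X n)) ^+ 2) <= (C + C) ^+ 2 * (N%:R * Delta).
Proof.
move=> kX XC.
apply: le_trans (@variance_sum_le _ predT _ X C s kX XC _) _.
  by move=> j k jk n m; rewrite !inE => /eqP-> /eqP->.
rewrite ler_wpM2l ?sqr_ge0//.
rewrite -[X in X%:R * _]card_ord mulr_natl -sumr_const.
by apply: ler_sum => n _.
Qed.

(** Two connected pairs [(n, m)] and [(k, l)] are linked in one of four ways. Each way is a chain:
    choose a first dyad in [N] ways, then three times a neighbour of one already chosen. *)
Lemma four_point_count :
  \sum_(n < N) \sum_(m < N | s n m) \sum_(k < N) \sum_(l < N | s k l)
    ((s n k)%:R + (s n l)%:R + (s m k)%:R + (s m l)%:R) <=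
  4 * (N%:R * Delta ^+ 3) :> R.
Proof.
have D0 (n : 'I_N) := degree_ge0 n.
have key (a : 'I_N) : \sum_(k < N) \sum_(l < N | s k l) (s a k)%:R <= Delta ^+ 2.
  apply: (@le_trans _ _ (\sum_k (s a k)%:R * Delta)).
    apply: ler_sum => k _; rewrite big_mkcond/=.
    rewrite (eq_bigr (fun l => (s a k)%:R * (s k l)%:R)); last first.
      by move=> l _; case: (s k l); rewrite ?mulr1 ?mulr0.
    by rewrite -big_distrr/= ler_wpM2l.
  by rewrite -big_distrl/= expr2 ler_wpM2r// (D0 a).
have key' (a : 'I_N) : \sum_(k < N) \sum_(l < N | s k l) (s a l)%:R <= Delta ^+ 2.
  rewrite (exchange_big_dep predT)//=.
  under eq_bigr do under eq_bigl do rewrite share_unitC.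
  exact: key.
apply: (@le_trans _ _ (\sum_(n < N) \sum_(m < N | s n m) 4 * Delta ^+ 2)).
  apply: ler_sum => n _; apply: ler_sum => m _.
  under eq_bigr do rewrite !big_split/=.
  rewrite !big_split/=.
  rewrite [leRHS](_ : _ = Delta ^+ 2 + Delta ^+ 2 + Delta ^+ 2 + Delta ^+ 2); last by ring.
  by rewrite !lerD.
rewrite [leRHS](_ : _ = \sum_(n < N) 4 * Delta ^+ 3); last first.
  by rewrite sumr_const card_ord -[RHS]mulr_natl; ring.
apply: ler_sum => n _.
rewrite big_mkcond/= (eq_bigr (fun m => (s n m)%:R * (4 * Delta ^+ 2))); last first.
  by move=> m _; case: (s n m); rewrite ?mul1r ?mul0r.
rewrite -big_distrl/= (_ : 4 * Delta ^+ 3 = Delta * (4 * Delta ^+ 2)); last by ring.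
rewrite ler_wpM2r//.
by rewrite mulr_ge0 ?sqr_ge0.
Qed.

Lemma variance_sum2_le (X : 'I_N -> 'I_N -> T -> R) (C : R) :
  (forall n m, known V [set n; m]%SET (X n m)) -> (forall n m w, `|X n m w| <= C) ->
  E (fun w => (\sum_n \sum_(m | s n m) X n m w
              - \sum_n \sum_(m | s n m) E (X n m)) ^+ 2)
  <= (C + C) ^+ 2 * (4 * (N%:R * Delta ^+ 3)).
Proof.
move=> kX XC.
pose conn (i j : 'I_N * 'I_N) := [|| s i.1 j.1, s i.1 j.2, s i.2 j.1 | s i.2 j.2].
have := @variance_sum_le _ (fun i : 'I_N * 'I_N => s i.1 i.2)
  (fun i => [set i.1; i.2]%SET) (fun i => X i.1 i.2) C conn.
move=> /(_ (fun i => kX _ _) (fun i => XC _ _)) H.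
have {}H := H _.
rewrite (_ : (fun w => _) = (fun w : T => (\sum_(j : 'I_N * 'I_N | s j.1 j.2) X j.1 j.2 w -
         \sum_(j : 'I_N * 'I_N | s j.1 j.2) E (X j.1 j.2)) ^+ 2)); last first.
  by apply/funext => w; rewrite !pair_big_dep.
apply: le_trans (H _) _.
  move=> i j; rewrite !negb_or => /and4P[h1 h2 h3 h4] n m.
  by rewrite !inE => /orP[] /eqP-> /orP[] /eqP->.
rewrite ler_wpM2l ?sqr_ge0//; apply: le_trans four_point_count.
rewrite [leRHS]pair_big_dep/=; apply: ler_sum => i _.
rewrite [leRHS]pair_big_dep/=; apply: ler_sum => j _.
rewrite /conn; case: (s i.1 j.1) => /=; first by rewrite -!natrD ler_nat.
by case: (s i.1 j.2) => /=; [|case: (s i.2 j.1) => /=; [|case: (s i.2 j.2) => /=]];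
  rewrite -!natrD ler_nat.
Qed.

End local_dependence.

(** * Stein's bound for locally dependent sums *)

Section stein_bound.
Context (R : realType) d (T : measurableType d) (P : probability T R).
Variables (G N : nat) (psi : 'I_N -> {set 'I_G}).
Hypothesis dyads : dyad_enumeration psi.
Context d' (T' : measurableType d').
Variable V : 'I_N -> T -> T'.
Hypothesis mV : forall n, measurable_fun setT (V n).
Hypothesis indep : forall S1 S2 : {set 'I_N},
  (forall n m, n \in S1 -> m \in S2 -> ~~ share_unit psi n m) ->
  independent_subfamilies P V S1 S2.
Local Notation E := (expect P).
Local Notation s := (share_unit psi).
Variable Delta : R.
Hypothesis degree : forall n, \sum_m (s n m)%:R <= Delta.
Variables (Z : 'I_N -> T -> R) (B : R).
Hypothesis kZ : forall n, known V [set n]%SET (Z n).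
Hypothesis ZB : forall n w, `|Z n w| <= B.
Hypothesis B0 : 0 <= B.
Hypothesis EZ : forall n, E (Z n) = 0.

Local Notation M := ((max_dyads_of psi)%:R : R).
Let S w := \sum_n Z n w.
Let nb n w := \sum_(m | s n m) Z m w.
Let ESS := E (fun w => S w ^+ 2).

Let bZ n : bounded_mfun (Z n). Proof. exact: known_bounded_mfun (kZ n). Qed.
Let bS : bounded_mfun S. Proof. exact: bounded_mfun_sum. Qed.
Let bnb n : bounded_mfun (nb n). Proof. exact: bounded_mfun_sum. Qed.

Lemma second_moment_sum : ESS = \sum_n \sum_(m | s n m) E (fun w => Z n w * Z m w).
Proof.
rewrite /ESS (_ : (fun w => S w ^+ 2) = fun w => \sum_n \sum_m Z n w * Z m w); last first.
  apply/funext => w; rewrite expr2 big_distrl/=.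
  by apply: eq_bigr => n _; rewrite big_distrr.
rewrite expect_sum; last by move=> n; bounded_mfun_tac.
apply: eq_bigr => n _; rewrite expect_sum; last by move=> m; bounded_mfun_tac.
rewrite [RHS]big_mkcond; apply: eq_bigr => m _.
case: ifPn => // nm; rewrite (expectM_known mV (indep _) (kZ n) (kZ m)) ?EZ ?mul0r//.
by move=> i j; rewrite !inE => /eqP-> /eqP->.
Qed.

Lemma second_moment_local : ESS = E (fun w => \sum_n Z n w * nb n w).
Proof.
rewrite second_moment_sum expect_sum; last by move=> n; bounded_mfun_tac.
apply: eq_bigr => n _; rewrite -expect_sum; last by move=> m; bounded_mfun_tac.
by congr E; apply/funext => w; rewrite big_distrr.
Qed.

Let ZZ n : E (fun w => Z n w ^+ 2) <= B ^+ 2.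
Proof.
rewrite (le_trans (ler_norm _))// expect_bound//; first by bounded_mfun_tac.
by move=> w; rewrite normrX ler_pXn2r ?nnegrE ?normr_ge0 ?(le_trans _ (ZB n w)).
Qed.

Let unit_total (g : 'I_G) w := \sum_(m | g \in psi m) Z m w.

(* Two distinct dyads share at most one unit, so the squared unit totals sum to
   the variance of the whole sum up to a diagonal term. *)
Lemma second_moment_unit_totals :
  E (fun w => \sum_g unit_total g w ^+ 2) <= ESS + N%:R * B ^+ 2.
Proof.
have -> : (fun w => \sum_g unit_total g w ^+ 2) =
    (fun w => \sum_n Z n w * nb n w + \sum_n Z n w ^+ 2).
  apply/funext => w; rewrite -big_split/=.
  transitivity (\sum_n Z n w * (nb n w + Z n w)); last first.
    by apply: eq_bigr => n _; rewrite mulrDr expr2.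
  under [RHS]eq_bigr do rewrite (sum_common_units dyads _ (Z^~ w)) big_distrr/=.
  rewrite [RHS](exchange_big_dep predT)//=; apply: eq_bigr => g _.
  by rewrite expr2 [X in X * _]/unit_total big_distrl.
rewrite expectD; [|bounded_mfun_tac..].
rewrite -second_moment_local lerD2l expect_sum; last by move=> n; bounded_mfun_tac.
rewrite [leRHS](_ : _ = \sum_(n < N) B ^+ 2); first by apply: ler_sum => n _.
by rewrite sumr_const card_ord mulr_natl.
Qed.

(* With the unit totals this is of order [M ESS] instead of the naive [N M ^ 2],
   which is what lets the third-order term of Stein's method vanish for small [r]. *)
Lemma second_moment_neighbourhoods :
  E (fun w => \sum_n nb n w ^+ 2) <=
  4 * M * (ESS + N%:R * B ^+ 2) + 2 * (N%:R * B ^+ 2).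
Proof.
have bU g : bounded_mfun (unit_total g) by exact: bounded_mfun_sum.
apply: (@le_trans _ _ (E (fun w => 4 * M * (\sum_g unit_total g w ^+ 2) + 2 * \sum_n Z n w ^+ 2))).
  apply: le_expect; [bounded_mfun_tac|bounded_mfun_tac|move=> w].
  apply: (@le_trans _ _ (\sum_n (4 * (\sum_(g in psi n) unit_total g w ^+ 2) + 2 * Z n w ^+ 2))).
    apply: ler_sum => n _.
    have -> : nb n w = \sum_(g in psi n) unit_total g w - Z n w.
      by rewrite -(sum_common_units dyads _ (Z^~ w)) addrK.
    (* For [n = {a, b}] this is [(x + y - z) ^+ 2 <= 4 * (x ^+ 2 + y ^+ 2) + 2 * z ^+ 2], with the
       difference displayed as a sum of squares. Summed over [n], each unit total then occurs once
       per dyad of its unit, at most [M] times. *)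
    have /eqP/cards2P[a [b [ab ->]]] := dyads.2 n.
    rewrite !big_setU1 ?inE//= !big_set1.
    rewrite -subr_ge0; set x := unit_total a w; set y := unit_total b w; set z := Z n w.
    rewrite (_ : _ - _ = (x + y + z) ^+ 2 + 2 * (x - y) ^+ 2); last by ring.
    by rewrite addr_ge0 ?sqr_ge0// mulr_ge0 ?sqr_ge0.
  rewrite big_split/= -!big_distrr/= lerD2r -mulrA ler_wpM2l//.
  rewrite (exchange_big_dep predT)//= big_distrr/=; apply: ler_sum => g _.
  rewrite sumr_const -[leLHS]mulr_natl ler_wpM2r ?sqr_ge0// ler_nat.
  exact: (@leq_bigmax _ (fun g => dyads_of psi g)).
rewrite expectD; [|bounded_mfun_tac..].
rewrite !expectZl; [|bounded_mfun_tac..].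
apply: lerD.
  by rewrite ler_wpM2l ?mulr_ge0// second_moment_unit_totals.
rewrite ler_wpM2l// expect_sum; last by move=> n; bounded_mfun_tac.
rewrite [leRHS](_ : _ = \sum_(n < N) B ^+ 2); first by apply: ler_sum => n _.
by rewrite sumr_const card_ord mulr_natl.
Qed.

Lemma variance_local :
  E (fun w => (\sum_n Z n w * nb n w - ESS) ^+ 2) <=
  (B ^+ 2 + B ^+ 2) ^+ 2 * (4 * (N%:R * Delta ^+ 3)).
Proof.
have kZZ n m : known V [set n; m]%SET (fun w => Z n w * Z m w).
  apply: bounded_mfunM; apply: known_sub (kZ _); rewrite finset.sub1set !inE eqxx ?orbT//.
have ZZB n m w : `|Z n w * Z m w| <= B ^+ 2 by rewrite normrM expr2 ler_pM.
rewrite (_ : (fun w => _) = (fun w => (\sum_n \sum_(m | s n m) Z n w * Z m w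
   - \sum_n \sum_(m | s n m) E (fun w => Z n w * Z m w)) ^+ 2)).
  exact: (variance_sum2_le mV indep degree kZZ ZZB).
apply/funext => w; rewrite second_moment_sum; congr ((_ - _) ^+ 2).
by apply: eq_bigr => n _; rewrite big_distrr.
Qed.

(** The free level [theta] replaces Cauchy-Schwarz: [|a| <= theta + a ^+ 2 / theta] bounds a first
    moment by a second one without square roots, and [theta] can be fixed before [G] grows. *)
Lemma stein_bound (f df : R -> R) (C sig theta : R) :
  (forall x : R, is_derive x 1 f (df x)) ->
  (forall x, `|f x| <= C) -> (forall x, `|df x| <= C) ->
  (forall x y, `|df x - df y| <= C * `|x - y|) ->
  0 < sig -> sig ^+ 2 = ESS -> 0 < theta ->
  `|E (fun w => df (S w / sig) - (S w / sig) * f (S w / sig))| <=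
  C * (theta + (B ^+ 2 + B ^+ 2) ^+ 2 * (4 * (N%:R * Delta ^+ 3)) / sig ^+ 4 / theta) +
  C * B * (4 * M * (ESS + N%:R * B ^+ 2) + 2 * (N%:R * B ^+ 2)) / sig ^+ 3.
Proof.
move=> f' fC dfC dfL sig0 sigE theta0.
have C0 : 0 <= C by apply: le_trans (fC 0).
have cf : continuous f by exact: is_derive_continuous f'.
have cdf : continuous df by exact: lipschitz_continuous_fun dfL.
have sign0 : sig != 0 by rewrite gt_eqF.
pose W w := S w / sig.
have bW : bounded_mfun W by rewrite /W; bounded_mfun_tac.
have bfW : bounded_mfun (fun w => f (W w)) by apply: bounded_mfun_comp => //; exists C.
have bdfW : bounded_mfun (fun w => df (W w)) by apply: bounded_mfun_comp => //; exists C.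
pose W' n w := (S w - nb n w) / sig.
have kW' n : known V [set m | ~~ s n m]%SET (W' n).
  rewrite (_ : W' n = fun w => (\sum_m if ~~ s n m then Z m w else 0) / sig); last first.
    by apply/funext => w; rewrite /W' /S /nb (bigID (s n))/= addrAC subrr add0r -big_mkcond.
  apply: bounded_mfunM; last exact: bounded_mfun_cst.
  apply: bounded_mfun_sum => m; case nm: (s n m) => /=; first exact: bounded_mfun_cst.
  by apply: known_sub (kZ m); rewrite finset.sub1set inE nm.
have kfW' n : known V [set m | ~~ s n m]%SET (fun w => f (W' n w)).
  by apply: bounded_mfun_comp => //; [exists C|exact: kW'].
have bfW' n : bounded_mfun (fun w => f (W' n w)) by exact: known_bounded_mfun (kfW' n).
have EZf n : E (fun w => Z n w * f (W' n w)) = 0.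
  rewrite (expectM_known mV (indep _) (kZ n) (kfW' n)) ?EZ ?mul0r//.
  by move=> i j; rewrite !inE => /eqP->.
pose Q w := \sum_n Z n w * nb n w.
have bQ : bounded_mfun Q by rewrite /Q; bounded_mfun_tac.
have EWf : E (fun w => W w * f (W w)) =
    E (fun w => sig^-1 * \sum_n Z n w * (f (W w) - f (W' n w))).
  rewrite (_ : (fun w => W w * f (W w)) = (fun w => sig^-1 * \sum_n Z n w * f (W w))); last first.
    by apply/funext => w; rewrite -big_distrl/= mulrA /W [S w / sig]mulrC.
  rewrite !expectZl; [|bounded_mfun_tac..].
  congr (_ * _); rewrite !expect_sum; [|move=> n; bounded_mfun_tac..].
  apply: eq_bigr => n _.
  rewrite -[LHS]subr0 -(EZf n) -expectB; [|bounded_mfun_tac..].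
  by congr E; apply/funext => w; rewrite mulrBr.
rewrite expectB; [|bounded_mfun_tac..].
rewrite EWf -expectB; [|bounded_mfun_tac..].
have bound w : `|df (W w) - sig^-1 * \sum_n Z n w * (f (W w) - f (W' n w))| <=
   C * (theta + (Q w - ESS) ^+ 2 / sig ^+ 4 / theta) + C * B / sig ^+ 3 * \sum_n nb n w ^+ 2.
  (* The first-order terms of the expansions add up to [df (W w) * Q w / sig ^+ 2], whose factor
     [Q w / sig ^+ 2] has mean 1 because [sig ^+ 2 = ESS]; what remains are the second-order Taylor
     remainders. *)
  have -> : df (W w) - sig^-1 * \sum_n Z n w * (f (W w) - f (W' n w)) =
     df (W w) * (1 - Q w / sig ^+ 2) -
     sig^-1 * \sum_n Z n w * (f (W w) - f (W' n w) - (W w - W' n w) * df (W w)).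
    have -> : \sum_n Z n w * (f (W w) - f (W' n w) - (W w - W' n w) * df (W w)) =
       \sum_n Z n w * (f (W w) - f (W' n w)) - Q w / sig * df (W w).
      rewrite /Q mulrAC 2!big_distrl/= -sumrB; apply: eq_bigr => n _.
      by rewrite /W /W'; field.
    by field.
  apply: le_trans (ler_normB _ _) _; apply: lerD.
    rewrite normrM ler_pM//.
    set a := 1 - _.
    have -> : (Q w - ESS) ^+ 2 / sig ^+ 4 = a ^+ 2.
      by rewrite /a -sigE; field.
    have [ath|/ltW tha] := leP `|a| theta.
      by rewrite (le_trans ath)// lerDl divr_ge0 ?sqr_ge0// ltW.
    rewrite -[leLHS]add0r lerD ?(ltW theta0)// ler_pdivlMr//.
    by rewrite -(ger0_norm (sqr_ge0 a)) normrX expr2 ler_wpM2l.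
  rewrite normrM ger0_norm ?invr_ge0 ?(ltW sig0)//.
  have -> : C * B / sig ^+ 3 * \sum_n nb n w ^+ 2 =
      sig^-1 * \sum_n B * (C * (nb n w / sig) ^+ 2).
    rewrite !big_distrr/=; apply: eq_bigr => n _; by field.
  rewrite ler_wpM2l ?invr_ge0 ?(ltW sig0)//.
  apply: le_trans (ler_norm_sum _ _ _) _; apply: ler_sum => n _.
  rewrite normrM ler_pM//.
  rewrite [nb n w / sig](_ : _ = W w - W' n w); last by rewrite /W /W'; field.
  exact: taylor_bound f' dfL _ _.
apply: (le_trans (normr_expect _ _)); first by bounded_mfun_tac.
apply: (@le_trans _ _ (E (fun w => C * (theta + (Q w - ESS) ^+ 2 / sig ^+ 4 / theta) +
    C * B / sig ^+ 3 * \sum_n nb n w ^+ 2))).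
  by apply: le_expect => //; bounded_mfun_tac.
rewrite expectD; [|bounded_mfun_tac..].
rewrite !expectZl; [|bounded_mfun_tac..].
rewrite expectD ?expect_cst; [|bounded_mfun_tac..].
apply: lerD.
  rewrite ler_wpM2l// lerD2l.
  rewrite (_ : (fun x => _) = (fun x => (sig ^+ 4)^-1 / theta * (Q x - ESS) ^+ 2)); last first.
    by apply/funext => w; ring.
  rewrite expectZl; last by bounded_mfun_tac.
  rewrite -[leRHS]mulrA [leRHS]mulrC ler_wpM2l//; last exact: variance_local.
  by rewrite divr_ge0 ?(ltW theta0)// invr_ge0 exprn_ge0 ?(ltW sig0).
rewrite [leRHS]mulrAC ler_wpM2l ?divr_ge0 ?mulr_ge0 ?exprn_ge0 ?(ltW sig0)//.
exact: second_moment_neighbourhoods.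
Qed.

End stein_bound.

(** * Convergence in probability *)

Section high_probability.
Context (R : realType) (d : nat -> measure_display)
  (T : forall G, measurableType (d G)) (P : forall G, probability (T G) R).

(* Convergence along this filter is convergence in probability. *)
Definition whp : set_system {G : nat & T G} := fun Q =>
  forall del, 0 < del -> \forall G \near \oo, exists A : set (T G),
    [/\ measurable A, fine (P G (~` A)) <= del &
        forall w, A w -> Q (existT _ G w)].

Definition at_sample (X : forall G, T G -> R) (z : {G : nat & T G}) : R :=
  X (projT1 z) (projT2 z).

Lemma fine_prob_setU G (A B : set (T G)) : measurable A -> measurable B ->
  fine (P G (A `|` B)) <= fine (P G A) + fine (P G B).
Proof.
move=> mA mB; rewrite -fineD ?fin_num_measure//.
rewrite fine_le ?fin_numD ?fin_num_measure//; first exact: measurableU.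
exact: measureU2.
Qed.

Global Instance whp_filter : Filter whp.
Proof.
constructor.
- move=> del del0; near=> G; exists setT; split => //.
  by rewrite setCT measure0/= ltW.
- move=> Q1 Q2 h1 h2 del del0.
  have del20 : 0 < del / 2 by rewrite divr_gt0.
  near=> G.
  have [A1 [mA1 PA1 A1Q]] : exists A : set (T G),
    [/\ measurable A, fine (P G (~` A)) <= del / 2 &
        forall w, A w -> Q1 (existT _ G w)] by near: G; exact: h1.
  have [A2 [mA2 PA2 A2Q]] : exists A : set (T G),
    [/\ measurable A, fine (P G (~` A)) <= del / 2 &
        forall w, A w -> Q2 (existT _ G w)] by near: G; exact: h2.
  exists (A1 `&` A2); split; first exact: measurableI.
    rewrite setCI; apply: (le_trans (fine_prob_setU _ _)); try exact: measurableC.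
    lra.
  by move=> w [/A1Q ? /A2Q ?]; split.
- move=> Q1 Q2 Q12 h1 del /h1; apply: filterS => G [A [mA PA AQ]].
  by exists A; split => // w /AQ/Q12.
Unshelve. all: by end_near. Qed.

Lemma whp_near (Q : nat -> Prop) : (\forall G \near \oo, Q G) ->
  \forall z \near whp, Q (projT1 z).
Proof.
move=> nQ del del0; apply: filterS nQ => G QG.
by exists setT; split => //; rewrite setCT measure0/= ltW.
Qed.

Lemma whp_cvg (c : nat -> R) (l : R) : c G @[G --> \oo] --> l ->
  c (projT1 z) @[z --> whp] --> l.
Proof.
move=> cl; apply/cvgrPdist_le => e e0.
by move/cvgrPdist_le : cl => /(_ e e0)/whp_near.
Qed.

Lemma whp_ae (Q : forall G, T G -> Prop) :
  (forall G, {ae P G, forall w, Q G w}) ->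
  \forall z \near whp, Q (projT1 z) (projT2 z).
Proof.
move=> aeQ del del0; near=> G.
have [B [mB PB QB]] := aeQ G.
exists (~` B); split; first exact: measurableC.
  by rewrite setCK PB/= ltW.
by move=> w /= nBw; apply: contrapT => /QB.
Unshelve. all: by end_near. Qed.

(* Markov's inequality and [2 |x y| <= x^2 / th + th y^2], with [th] chosen small
   before [E X^2] is. *)
Lemma whp_cvg_mul (X Y : forall G, T G -> R) (q : R) :
  (forall G, bounded_mfun (X G)) -> (forall G, bounded_mfun (Y G)) ->
  expect (P G) (fun w => X G w ^+ 2) @[G --> \oo] --> 0 ->
  (\forall G \near \oo, expect (P G) (fun w => Y G w ^+ 2) <= q) ->
  at_sample (fun G w => X G w * Y G w) z @[z --> whp] --> (0 : R).
Proof.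
move=> bX bY EX EY; apply/cvgrPdist_lt => e e0 del del0.
pose q1 := `|q| + 1; have q10 : 0 < q1 by rewrite ltr_wpDl.
(* Once [E X^2 <= e * del * th], both terms of the bound are at most [e * del / 2]; dividing by [e]
   in Markov's inequality leaves [del]. *)
pose th := e * del / q1; have th0 : 0 < th by rewrite divr_gt0 ?mulr_gt0.
have th1 : 0 < e * del * th by exact: mulr_gt0 (mulr_gt0 e0 del0) th0.
move/cvgrPdist_le/(_ _ th1) : EX => EX.
near=> G.
have EXG : `|0 - expect (P G) (fun w => X G w ^+ 2)| <= e * del * th by near: G.
have EYG : expect (P G) (fun w => Y G w ^+ 2) <= q by near: G.
pose Z w := `|X G w * Y G w|.
have bXG := bX G; have bYG := bY G.
have bZ : bounded_mfun Z by rewrite /Z; bounded_mfun_tac.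
have mA : measurable [set w | e <= Z w].
  rewrite [X in measurable X](_ : _ = setT `&` Z @^-1` `[e, +oo[); last first.
    by apply/seteqP; split => w /=; rewrite in_itv/= andbT; [split|case].
  by case: bZ => mZ _; exact: mZ.
exists (~` [set w | e <= Z w]); split; first exact: measurableC.
  rewrite setCK.
  have := markov_expect (P G) bZ (fun w => normr_ge0 _) e0.
  have : expect (P G) Z <= expect (P G) (fun w => th^-1 / 2 * X G w ^+ 2 + th / 2 * Y G w ^+ 2).
    apply: le_expect => //; first by bounded_mfun_tac.
    move=> w; rewrite /Z normrM; set a := X G w; set b := Y G w.
    rewrite -(real_normK (num_real a)) -(real_normK (num_real b)) -subr_ge0.
    rewrite (_ : _ - _ = th^-1 / 2 * (`|a| - th * `|b|) ^+ 2); last by field; rewrite gt_eqF.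
    by rewrite mulr_ge0 ?sqr_ge0// divr_ge0// invr_ge0 ltW.
  rewrite expectD; [|bounded_mfun_tac..].
  rewrite !expectZl; [|bounded_mfun_tac..].
  move=> h1 h2; rewrite -(ler_pM2l e0); apply: (le_trans h2); apply: (le_trans h1).
  move: EXG; rewrite sub0r normrN => /(le_trans (ler_norm _)) EXG.
  have h3 : th^-1 / 2 * expect (P G) (fun w => X G w ^+ 2) <= e * del / 2.
    rewrite (_ : e * del / 2 = th^-1 / 2 * (e * del * th)); last by field; rewrite gt_eqF.
    by rewrite ler_wpM2l// divr_ge0// invr_ge0 ltW.
  have h4 : th / 2 * expect (P G) (fun w => Y G w ^+ 2) <= e * del / 2.
    apply: (@le_trans _ _ (th / 2 * q1)).
      apply: ler_wpM2l; first by rewrite divr_ge0// ltW.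
      apply: (le_trans EYG).
      by rewrite /q1 (le_trans (ler_norm _))// lerDl.
    by rewrite le_eqVlt; apply/orP; left; apply/eqP; rewrite /th; field; rewrite gt_eqF.
  by apply: (le_trans (lerD h3 h4)); rewrite le_eqVlt; apply/orP; left; apply/eqP; field.
by move=> w /= /negP; rewrite -ltNge /Z sub0r normrN.
Unshelve. all: by end_near. Qed.

Lemma whp_cvg_L2 (X : forall G, T G -> R) : (forall G, bounded_mfun (X G)) ->
  expect (P G) (fun w => X G w ^+ 2) @[G --> \oo] --> 0 ->
  at_sample X z @[z --> whp] --> (0 : R).
Proof.
move=> bX EX; have := @whp_cvg_mul X (fun _ _ => 1) 1 bX (fun=> bounded_mfun_cst _ _) EX.
under [X in X @ _ --> _]eq_fun do rewrite /at_sample mulr1; apply.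
by near=> G; rewrite expr1n expect_cst.
Unshelve. all: by end_near. Qed.

End high_probability.

(** * Entrywise limits of matrices *)

Section entrywise_limits.
Context (R : realType) (I : Type) (F : set_system I) {FF : Filter F}.

Lemma cvg_sumf (J : Type) (r : seq J) (p : pred J) (f : J -> I -> R) (l : J -> R) :
  (forall j, f j z @[z --> F] --> l j) ->
  \sum_(j <- r | p j) f j z @[z --> F] --> \sum_(j <- r | p j) l j.
Proof. by move=> fl; apply: cvg_big => //; exact: add_continuous. Qed.

Lemma cvg_prodf (J : Type) (r : seq J) (p : pred J) (f : J -> I -> R) (l : J -> R) :
  (forall j, f j z @[z --> F] --> l j) ->
  \prod_(j <- r | p j) f j z @[z --> F] --> \prod_(j <- r | p j) l j.
Proof. by move=> fl; apply: cvg_big => //; exact: mul_continuous. Qed.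

Definition mcvg m n (A : I -> 'M[R]_(m, n)) (L : 'M[R]_(m, n)) :=
  forall i j, A z i j @[z --> F] --> L i j.

Lemma mcvg_mulmx m n p (A : I -> 'M[R]_(m, n)) (B : I -> 'M[R]_(n, p)) LA LB :
  mcvg A LA -> mcvg B LB -> mcvg (fun z => A z *m B z) (LA *m LB).
Proof.
move=> AL BL i j; rewrite mxE; under eq_fun do rewrite mxE.
by apply: cvg_sumf => k; apply: cvgM.
Qed.

Lemma cvg_det n (A : I -> 'M[R]_n) L : mcvg A L -> \det (A z) @[z --> F] --> \det L.
Proof.
move=> AL; apply: cvg_sumf => s; apply: cvgM; first exact: cvg_cst.
by apply: cvg_prodf => i; exact: AL.
Qed.

(** By Cramer's rule the inverse is the adjugate over the determinant. Both are polynomial in the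
    entries, and the determinant eventually avoids 0. *)
Lemma mcvg_invmx n (A : I -> 'M[R]_n) L : mcvg A L -> L \in unitmx ->
  (\forall z \near F, A z \in unitmx) /\ mcvg (fun z => invmx (A z)) (invmx L).
Proof.
move=> AL uL.
have dL : \det L != 0 by rewrite -unitfE -unitmxE.
have uA : \forall z \near F, A z \in unitmx.
  have := @cvgr_neq0 R R I F FF _ _ (cvg_det AL) dL.
  by apply: filterS => z; rewrite unitmxE unitfE.
split => // i j.
suff : (\det (A z))^-1 * (\adj (A z)) i j @[z --> F] --> invmx L i j.
  apply: cvg_trans; apply: near_eq_cvg; apply: filterS uA => z uAz.
  by rewrite /invmx uAz [RHS]mxE.
rewrite /invmx uL mxE; apply: cvgM; first exact: cvgV dL (cvg_det AL).
rewrite mxE; under eq_fun do rewrite mxE.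
apply: cvgM; first exact: cvg_cst.
apply: cvg_det => a b; rewrite !mxE; under eq_fun do rewrite !mxE.
exact: AL.
Qed.

Lemma cvg_gt0_near (f : I -> R) l : f z @[z --> F] --> l -> 0 < l ->
  \forall z \near F, 0 < f z.
Proof. by move=> fl l0; exact: (@cvgr_gt _ I F FF f l fl 0 l0). Qed.

Lemma cvg_norm0 (f : I -> R) : f z @[z --> F] --> (0 : R) -> `|f z| @[z --> F] --> (0 : R).
Proof. by move=> /cvg_norm; rewrite normr0. Qed.

Lemma cvg_le0 (f g : I -> R) : (\forall z \near F, `|f z| <= g z) ->
  g z @[z --> F] --> (0 : R) -> f z @[z --> F] --> (0 : R).
Proof.
move=> fg /cvgrPdist_le g0; apply/cvgrPdist_le => e e0.
apply: filterS2 fg (g0 e e0) => z fgz; rewrite !sub0r !normrN => ge.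
by rewrite (le_trans fgz)// (le_trans (ler_norm _)).
Qed.

End entrywise_limits.

(** * The t-statistic *)

Lemma posdef_unitmx (R : realType) K (Q : 'M[R]_K) : posdef Q -> Q \in unitmx.
Proof.
move=> [_ Qpos]; rewrite -row_free_unit; apply: inj_row_free => r rQ.
apply/eqP; rewrite -(inj_eq trmx_inj) trmx0; apply: contraT => /Qpos.
by rewrite trmxK rQ mul0mx mxE ltxx.
Qed.

(** The entry is the quadratic form of [Om] at column [k] of [invmx Q], a nonzero vector. *)
Lemma posdef_quad_invmx (R : realType) K (Q Om : 'M[R]_K) k :
  posdef Q -> posdef Om -> 0 < (invmx Q *m Om *m invmx Q) k k.
Proof.
move=> Qpd [_ Ompos].
have uQ := posdef_unitmx Qpd; have [Qsym _] := Qpd.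
have QVsym : (invmx Q)^T = invmx Q by rewrite trmx_inv Qsym.
have e0 : invmx Q *m delta_mx k 0 != 0 :> 'cV_K.
  apply/eqP => /(congr1 (mulmx Q)); rewrite mulKVmx// mulmx0.
  by move=> /matrixP/(_ k 0); rewrite !mxE !eqxx => /eqP; rewrite oner_eq0.
have := Ompos _ e0; rewrite trmx_mul QVsym trmx_delta.
rewrite !mulmxA -rowE -!row_mul -colE.
by rewrite !mxE.
Qed.

(** * Algebra of a realized sample *)

Section sample_algebra.
Variables (R : realType) (K G N : nat) (psi : 'I_N -> {set 'I_G}).
Variables (x : 'I_N -> 'cV[R]_K) (u y : 'I_N -> R) (beta : 'cV[R]_K).
Hypothesis model : forall n, y n = dot beta (x n) + u n.

Lemma dotE (b c : 'cV[R]_K) : dot b c = \sum_l b l 0 * c l 0.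
Proof. by rewrite /dot mxE; apply: eq_bigr => l _; rewrite mxE. Qed.

Lemma gramE i j : gram x i j = \sum_n x n i 0 * x n j 0.
Proof.
rewrite /gram summxE; apply: eq_bigr => n _.
by rewrite mxE big_ord1 mxE.
Qed.

Lemma ols_error : gram x \in unitmx ->
  ols x y = beta + invmx (gram x) *m \sum_n u n *: x n.
Proof.
move=> ug; rewrite /ols.
have -> : \sum_n y n *: x n = gram x *m beta + \sum_n u n *: x n.
  rewrite /gram mulmx_suml -big_split/=; apply: eq_bigr => n _.
  rewrite model scalerDl; congr (_ + _).
  apply/colP => i; rewrite -mulmxA mxE mxE big_ord1 mulrC; congr (_ * _).
  by rewrite dotE mxE; apply: eq_bigr => l _; rewrite mxE mulrC.
by rewrite mulmxDr mulKmx.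
Qed.

Lemma residualE n :
  residual x y n = u n - \sum_l (ols x y - beta) l 0 * x n l 0.
Proof.
rewrite /residual model [RHS](_ : _ = u n - (dot (ols x y) (x n) - dot beta (x n))).
  by ring.
congr (_ - _); rewrite !dotE -sumrB; apply: eq_bigr => l _.
by rewrite !mxE mulrBl.
Qed.

Lemma meatE i j : (\sum_n \sum_m
    ((share_unit psi n m)%:R * residual x y n * residual x y m) *: (x n *m (x m)^T)) i j =
  \sum_n \sum_(m | share_unit psi n m) residual x y n * residual x y m * x n i 0 * x m j 0.
Proof.
rewrite summxE; apply: eq_bigr => n _; rewrite summxE [RHS]big_mkcond.
apply: eq_bigr => m _; rewrite mxE mxE big_ord1 mxE.
by case: share_unit; rewrite ?mul0r// mul1r !mulrA.
Qed.

(** Residual and error differ by at most [b * C], so a product of two changes by at most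
    [2 * C * (b * C) + (b * C) ^+ 2]. The regressors contribute [C ^+ 2], and there are at most
    [N * Delta] terms. *)
Lemma meat_error (C Delta : R) i j :
  (forall n l, `|x n l 0| <= C) -> (forall n, `|u n| <= C) ->
  (forall n, \sum_m (share_unit psi n m)%:R <= Delta) ->
  forall b, b = \sum_l `|(ols x y - beta) l 0| ->
  `| \sum_n \sum_(m | share_unit psi n m) residual x y n * residual x y m * x n i 0 * x m j 0
   - \sum_n \sum_(m | share_unit psi n m) u n * u m * x n i 0 * x m j 0|
  <= N%:R * Delta * (C ^+ 4 * (2 * b + b ^+ 2)).
Proof.
move=> xC uC deg b bE.
have b0 : 0 <= b by rewrite bE sumr_ge0.
have q n : `|\sum_l (ols x y - beta) l 0 * x n l 0| <= b * C.
  rewrite (le_trans (ler_norm_sum _ _ _))// bE big_distrl/=.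
  by apply: ler_sum => l _; rewrite normrM ler_wpM2l.
rewrite -sumrB.
have -> : N%:R * Delta * (C ^+ 4 * (2 * b + b ^+ 2)) =
    \sum_(n < N) Delta * (C ^+ 4 * (2 * b + b ^+ 2)).
  by rewrite sumr_const card_ord -[RHS]mulr_natl [RHS]mulrA.
apply: (le_trans (ler_norm_sum _ _ _)); apply: ler_sum => n _.
rewrite -sumrB; apply: (le_trans (ler_norm_sum _ _ _)).
have C0 : 0 <= C by apply: le_trans (uC n).
have C40 : 0 <= C ^+ 4 * (2 * b + b ^+ 2).
  by rewrite mulr_ge0 ?exprn_ge0// addr_ge0 ?sqr_ge0// mulr_ge0.
apply: (@le_trans _ _ (\sum_(m | share_unit psi n m) C ^+ 4 * (2 * b + b ^+ 2))); last first.
  rewrite big_mkcond/= (eq_bigr (fun m => (share_unit psi n m)%:R * (C ^+ 4 * (2 * b + b ^+ 2)))).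
    by rewrite -big_distrl/= ler_wpM2r.
  by move=> m _; case: share_unit; rewrite ?mul1r ?mul0r.
apply: ler_sum => m _.
rewrite -!mulrBl !normrM !residualE.
have := q n; have := q m.
set p := \sum_l _; set p' := \sum_l _ => p'C pC.
have -> : C ^+ 4 * (2 * b + b ^+ 2) = (C * (b * C) + C * (b * C) + b * C * (b * C)) * C * C by ring.
apply: ler_pM => //.
apply: ler_pM => //.
have -> : (u n - p') * (u m - p) - u n * u m = - (u n * p) - u m * p' + p' * p by ring.
rewrite (le_trans (ler_normD _ _))// lerD//; last by rewrite normrM ler_pM.
rewrite (le_trans (ler_normB _ _))// normrN !normrM lerD// ler_pM//.
Qed.

End sample_algebra.

(** * Asymptotics for general rates *)

Section asymptotics.
Unset Implicit Arguments.
Variables (R : realType) (K : nat).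
Context (d : nat -> measure_display) (T : forall G, measurableType (d G))
  (P : forall G, probability (T G) R).
Variables (N : nat -> nat) (psi : forall G, 'I_(N G) -> {set 'I_G}).
Hypothesis dyads : forall G, dyad_enumeration (psi G).
Context d' (T' : measurableType d').
Variable V : forall G, 'I_(N G) -> T G -> T'.
Hypothesis mV : forall G n, measurable_fun setT (V G n).
Hypothesis indep : forall G (S1 S2 : {set 'I_(N G)}),
  (forall n m, n \in S1 -> m \in S2 -> ~~ share_unit (psi G) n m) ->
  independent_subfamilies (P G) (V G) S1 S2.
Variables (x : forall G, 'I_(N G) -> 'I_K -> T G -> R)
  (u : forall G, 'I_(N G) -> T G -> R) (C : R).
Hypothesis kx : forall G n i, known (V G) [set n]%SET (x G n i).
Hypothesis ku : forall G n, known (V G) [set n]%SET (u G n).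
Hypothesis xC : forall G n i w, `|x G n i w| <= C.
Hypothesis uC : forall G n w, `|u G n w| <= C.
Hypothesis C0 : 0 <= C.
Variable Q : 'M[R]_K.
Hypothesis EQ : forall G n i j, expect (P G) (fun w => x G n i w * x G n j w) = Q i j.
Hypothesis E0 : forall G n i, expect (P G) (fun w => u G n w * x G n i w) = 0.
Hypothesis Qpd : posdef Q.
(* [N G * a G] is the order of the variance of the score sum ([a] is [1], [G] or
   [G ^ r]); [Dl G] bounds the number of dyads of a unit ([1] or [G] up to a
   constant). *)
Variables (a Dl : nat -> R).
Hypothesis N_infty : N G @[G --> \oo] --> \oo.
Hypothesis a1 : \forall G \near \oo, 1 <= a G.
Hypothesis aDl : \forall G \near \oo, a G <= Dl G.
Hypothesis mDl : forall G, (max_dyads_of (psi G))%:R <= Dl G.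
(** The square of [sqrt (N * Dl ^+ 3) / (N * a)], the relative fluctuation of the middle matrix. *)
Hypothesis rate : Dl G ^+ 3 / ((N G)%:R * a G ^+ 2) @[G --> \oo] --> (0 : R).

Let score G i w := \sum_n u G n w * x G n i w.
Let v G i j := expect (P G) (fun w => score G i w * score G j w).
Variable Om : 'M[R]_K.
Hypothesis vOm : forall i j, v G i j / ((N G)%:R * a G) @[G --> \oo] --> Om i j.
Hypothesis Ompd : posdef Om.

Let bx G n i : bounded_mfun (x G n i).
Proof. exact: known_bounded_mfun (kx G n i). Qed.
Let bu G n : bounded_mfun (u G n).
Proof. exact: known_bounded_mfun (ku G n). Qed.
Let bscore G i : bounded_mfun (score G i).
Proof. by rewrite /score; bounded_mfun_tac. Qed.

Let N_gt0 : \forall G \near \oo, 0 < (N G)%:R :> R.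
Proof.
have : \forall G \near \oo, (1 <= N G)%N.
  by move: N_infty => /(_ [set m | 1 <= m]%N); apply; exact: nbhs_infty_ge.
by apply: filterS => G; rewrite ltr0n.
Qed.

Let rate_facts : \forall G \near \oo,
  [/\ 0 < (N G)%:R :> R, 1 <= a G, 1 <= Dl G, a G <= Dl G & 0 < (N G)%:R * a G].
Proof.
near=> G.
have N0 : 0 < (N G)%:R :> R by near: G.
have aG : 1 <= a G by near: G.
have aD : a G <= Dl G by near: G.
by split => //; [exact: le_trans aD|rewrite mulr_gt0// (lt_le_trans _ aG)].
Unshelve. all: by end_near. Qed.

(** [rate] times [(a / Dl) ^+ 2 <= 1]; it drives the law of large numbers for the Gram matrix. *)
Let rate1 : Dl G / (N G)%:R @[G --> \oo] --> (0 : R).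
Proof.
apply: cvg_le0 rate; apply: filterS rate_facts => G [N0 aG DG aD _].
have a0 : 0 < a G by rewrite (lt_le_trans _ aG).
have D0 : 0 < Dl G by rewrite (lt_le_trans _ DG).
rewrite ger0_norm; last by rewrite divr_ge0// ltW.
rewrite ler_pdivrMr// mulrAC ler_pdivlMr ?mulr_gt0 ?exprn_gt0//.
rewrite (_ : Dl G * _ = (N G)%:R * Dl G * (a G * a G)); last by ring.
rewrite (_ : Dl G ^+ 3 * _ = (N G)%:R * Dl G * (Dl G * Dl G)); last by ring.
by rewrite ler_wpM2l ?mulr_ge0 ?(ltW N0) ?(ltW D0)// ler_pM// ltW.
Qed.

(** [rate] times [a / Dl <= 1]; it bounds the third-order Stein term and the effect of residuals. *)
Let rate2 : Dl G ^+ 2 / ((N G)%:R * a G) @[G --> \oo] --> (0 : R).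
Proof.
apply: cvg_le0 rate; apply: filterS rate_facts => G [N0 aG DG aD Na0].
have a0 : 0 < a G by rewrite (lt_le_trans _ aG).
have D0 : 0 < Dl G by rewrite (lt_le_trans _ DG).
rewrite ger0_norm; last by rewrite divr_ge0 ?exprn_ge0// ltW.
rewrite ler_pdivrMr// mulrAC ler_pdivlMr ?mulr_gt0 ?exprn_gt0//.
rewrite (_ : Dl G ^+ 2 * _ = (N G)%:R * a G * Dl G ^+ 2 * a G); last by ring.
rewrite (_ : Dl G ^+ 3 * _ = (N G)%:R * a G * Dl G ^+ 2 * Dl G); last by ring.
by rewrite ler_wpM2l// mulr_ge0 ?exprn_ge0// ltW.
Qed.

Let degree G n : \sum_m (share_unit (psi G) n m)%:R <= 2 * Dl G.
Proof. exact: (sum_share_unit_le (dyads G)). Qed.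

Local Notation ws := at_sample.

Let Ahat i j G w := (\sum_n x G n i w * x G n j w) / (N G)%:R.

Let xxC G n i j w : `|x G n i w * x G n j w| <= C ^+ 2.
Proof. by rewrite normrM expr2 ler_pM. Qed.

Let bAhat i j G : bounded_mfun (Ahat i j G).
Proof. by rewrite /Ahat; bounded_mfun_tac. Qed.

Let Ahat_L2 i j :
  expect (P G) (fun w => (Ahat i j G w - Q i j) ^+ 2) @[G --> \oo] --> (0 : R).
Proof.
apply: (@cvg_le0 _ _ _ _ _ (fun G => (C ^+ 2 + C ^+ 2) ^+ 2 * 2 * (Dl G / (N G)%:R))); last first.
  by rewrite -[X in _ --> X](mulr0 ((C ^+ 2 + C ^+ 2) ^+ 2 * 2)); apply: cvgM => //; exact: cvg_cst.
apply: filterS rate_facts => G [N0 _ DG _ _].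
have kxx n : known (V G) [set n]%SET (fun w => x G n i w * x G n j w).
  by apply: bounded_mfunM; exact: kx.
have := variance_sum1_le (mV G) (@indep G) (degree G) kxx (fun n => xxC G n i j).
rewrite (eq_bigr (fun=> Q i j)); last by move=> n _; rewrite EQ.
rewrite sumr_const card_ord -[Q i j *+ _]mulr_natl => H.
rewrite ger0_norm; last by apply: expect_ge0 => w; exact: sqr_ge0.
rewrite (_ : (fun w => _) = (fun w => (N G)%:R ^- 2 *
   (\sum_n x G n i w * x G n j w - (N G)%:R * Q i j) ^+ 2)); last first.
  by apply/funext => w; rewrite /Ahat; field; rewrite gt_eqF.
rewrite expectZl; last by bounded_mfun_tac.
rewrite (_ : _ * _ * (_ / _) = (N G)%:R ^- 2 * ((C ^+ 2 + C ^+ 2) ^+ 2 * ((N G)%:R * (2 * Dl G)))).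
  by rewrite ler_wpM2l// invr_ge0 exprn_ge0// ltW.
by field; rewrite gt_eqF.
Qed.

Lemma whp_gram i j : ws (Ahat i j) z @[z --> whp P] --> Q i j.
Proof.
have : ws (fun G w => Ahat i j G w - Q i j) z @[z --> whp P] --> (0 : R).
  by apply: whp_cvg_L2 => // G; apply: bounded_mfunD; [exact: bAhat|exact: bounded_mfun_cst].
move=> /cvgD/(_ (cvg_cst (Q i j))); rewrite add0r; apply: cvg_trans.
by apply: near_eq_cvg; near=> z; rewrite /at_sample subrK.
Unshelve. all: by end_near. Qed.

Let nu G := Num.sqrt ((N G)%:R * a G).
Let Y i G w := score G i w / nu G.
Let bY i G : bounded_mfun (Y i G).
Proof. by rewrite /Y; bounded_mfun_tac. Qed.

Let EY i : \forall G \near \oo, expect (P G) (fun w => Y i G w ^+ 2) <= Om i i + 1.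
Proof.
have /cvgrPdist_le/(_ 1 ltr01) := vOm i i.
apply: filterS2 rate_facts => G [_ _ _ _ Na0] H.
rewrite (_ : (fun w => _) =
    (fun w => ((N G)%:R * a G)^-1 * (score G i w * score G i w))); last first.
  apply/funext => w; rewrite /Y expr_div_n /nu sqr_sqrtr; last exact: ltW.
  by rewrite mulrC expr2.
rewrite expectZl; last by bounded_mfun_tac.
rewrite -/(v G i i) [leLHS]mulrC; move: H; rewrite ler_norml => /andP[+ _].
by set q := v G i i / _; lra.
Qed.

(** [Y] is bounded in L2 but has no limit along [whp P], so continuity of the product does not
    apply; this is the term that arises when the Gram matrix is replaced by its limit. *)
Lemma whp_gram_score i j l :
  ws (fun G w => (Ahat i j G w - Q i j) * Y l G w) z @[z --> whp P] --> (0 : R).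
Proof.
apply: (whp_cvg_mul (q := Om l l + 1)) => //.
by move=> G; apply: bounded_mfunD; [exact: bAhat|exact: bounded_mfun_cst].
Qed.

(* Replacing errors by residuals in the variance estimator costs
   [kap * |beta_hat - beta|]. *)
Let kap G := Dl G / a G.

(** The deterministic factor squares to [Dl ^+ 2 / (N * a)]. *)
Lemma whp_score_small j :
  ws (fun G w => kap G * (nu G / (N G)%:R) * Y j G w) z @[z --> whp P] --> (0 : R).
Proof.
apply: (whp_cvg_mul (q := Om j j + 1)) => //; first by move=> G; exact: bounded_mfun_cst.
apply: cvg_trans rate2; apply: near_eq_cvg; apply: filterS rate_facts => G [N0 aG _ _ Na0].
have a0 : a G != 0 by rewrite gt_eqF// (lt_le_trans _ aG).
rewrite expect_cst /kap exprMn expr_div_n /nu expr_div_n sqr_sqrtr ?(ltW Na0)//.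
by field; rewrite a0 gt_eqF.
Qed.

Let Bhat i j G w :=
  (\sum_n \sum_(m | share_unit (psi G) n m)
     u G n w * u G m w * x G n i w * x G m j w) / ((N G)%:R * a G).

Let bBhat i j G : bounded_mfun (Bhat i j G).
Proof. by rewrite /Bhat; bounded_mfun_tac. Qed.

Let v_local G i j : v G i j = \sum_n \sum_(m | share_unit (psi G) n m)
  expect (P G) (fun w => u G n w * u G m w * x G n i w * x G m j w).
Proof.
rewrite /v (_ : (fun w => _) = (fun w => \sum_n \sum_m
   (u G n w * x G n i w) * (u G m w * x G m j w))); last first.
  apply/funext => w; rewrite /score big_distrl/=; apply: eq_bigr => n _.
  by rewrite big_distrr.
rewrite expect_sum; last by move=> n; bounded_mfun_tac.
apply: eq_bigr => n _; rewrite expect_sum; last by move=> m; bounded_mfun_tac.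
rewrite [RHS]big_mkcond; apply: eq_bigr => m _.
case: ifPn => [nm|nm].
  by congr expect; apply/funext => w; ring.
rewrite (expectM_known (mV G) (indep G [set n]%SET [set m]%SET _)).
- by rewrite !E0 mul0r.
- by move=> i' j'; rewrite !inE => /eqP-> /eqP->.
- by apply: bounded_mfunM; [exact: ku|exact: kx].
- by apply: bounded_mfunM; [exact: ku|exact: kx].
Qed.

Let Bhat_L2 i j : expect (P G) (fun w => (Bhat i j G w - v G i j / ((N G)%:R * a G)) ^+ 2)
  @[G --> \oo] --> (0 : R).
Proof.
(* The factor 32 is [4 * 2 ^+ 3]: four ways to link two pairs, and neighbourhoods of size at most
   [2 * Dl G]. *)
apply: (@cvg_le0 _ _ _ _ _ (fun G => (C ^+ 4 + C ^+ 4) ^+ 2 * 32 *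
    (Dl G ^+ 3 / ((N G)%:R * a G ^+ 2)))); last first.
  rewrite -[X in _ --> X](mulr0 ((C ^+ 4 + C ^+ 4) ^+ 2 * 32)).
  by apply: cvgM => //; exact: cvg_cst.
apply: filterS rate_facts => G [N0 aG DG _ Na0].
have a0 : a G != 0 by rewrite gt_eqF// (lt_le_trans _ aG).
pose X n m w := u G n w * u G m w * x G n i w * x G m j w.
have kX n m : known (V G) [set n; m]%SET (X n m).
  have kun : known (V G) [set n; m]%SET (u G n).
    by apply: known_sub (ku G n); rewrite finset.sub1set !inE eqxx.
  have kum : known (V G) [set n; m]%SET (u G m).
    by apply: known_sub (ku G m); rewrite finset.sub1set !inE eqxx orbT.
  have kxn : known (V G) [set n; m]%SET (x G n i).
    by apply: known_sub (kx G n i); rewrite finset.sub1set !inE eqxx.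
  have kxm : known (V G) [set n; m]%SET (x G m j).
    by apply: known_sub (kx G m j); rewrite finset.sub1set !inE eqxx orbT.
  by do !apply: bounded_mfunM.
have XC n m w : `|X n m w| <= C ^+ 4.
  rewrite /X !normrM (_ : C ^+ 4 = C * C * C * C); last by ring.
  by rewrite !ler_pM.
have := variance_sum2_le (mV G) (@indep G) (degree G) kX XC.
rewrite -v_local => H.
rewrite ger0_norm; last by apply: expect_ge0 => w; exact: sqr_ge0.
rewrite (_ : (fun w => _) = (fun w => ((N G)%:R * a G) ^- 2 *
   (\sum_n \sum_(m | share_unit (psi G) n m) X n m w - v G i j) ^+ 2)); last first.
  by apply/funext => w; rewrite /Bhat -/(X _ _ _); field; rewrite a0 gt_eqF.
rewrite expectZl; last by rewrite /X; bounded_mfun_tac.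
rewrite (_ : _ * _ * (_ / _) = ((N G)%:R * a G) ^- 2 *
   ((C ^+ 4 + C ^+ 4) ^+ 2 * (4 * ((N G)%:R * (2 * Dl G) ^+ 3)))).
  by rewrite ler_wpM2l// invr_ge0 exprn_ge0// ltW.
by field; rewrite a0 gt_eqF.
Qed.

Lemma whp_meat i j : ws (Bhat i j) z @[z --> whp P] --> Om i j.
Proof.
have : ws (fun G w => Bhat i j G w - v G i j / ((N G)%:R * a G)) z @[z --> whp P] --> (0 : R).
  by apply: whp_cvg_L2 => // G; apply: bounded_mfunD; [exact: bBhat|exact: bounded_mfun_cst].
move=> /cvgD/(_ (whp_cvg P (vOm i j))); rewrite add0r; apply: cvg_trans.
by apply: near_eq_cvg; near=> z; rewrite /at_sample subrK.
Unshelve. all: by end_near. Qed.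

Variable k : 'I_K.
(** With these weights [S] is the leading term of [N] times the error of the [k]th coefficient, and
    [om] is the limit of its variance divided by [N * a]. *)
Let alpha i := invmx Q k i.
Let om := (invmx Q *m Om *m invmx Q) k k.
Let Z G n w := \sum_i alpha i * (u G n w * x G n i w).
Let S G w := \sum_n Z G n w.
Let ESS G := expect (P G) (fun w => S G w ^+ 2).
Let sig G := Num.sqrt (ESS G).
Let W G w := S G w / sig G.
Let B := (\sum_i `|alpha i|) * C ^+ 2.

Let SE G w : S G w = \sum_i alpha i * score G i w.
Proof.
rewrite /S /Z exchange_big/=; apply: eq_bigr => i _.
by rewrite /score big_distrr.
Qed.

Let bS G : bounded_mfun (S G).
Proof. by rewrite /S /Z; bounded_mfun_tac. Qed.

Let kZ G n : known (V G) [set n]%SET (Z G n).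
Proof.
apply: bounded_mfun_sum => i; apply: bounded_mfunM; first exact: bounded_mfun_cst.
by apply: bounded_mfunM; [exact: ku|exact: kx].
Qed.

Let ZB G n w : `|Z G n w| <= B.
Proof.
rewrite (le_trans (ler_norm_sum _ _ _))// /B big_distrl/=.
by apply: ler_sum => i _; rewrite normrM ler_wpM2l// normrM expr2 ler_pM.
Qed.

Let EZ G n : expect (P G) (Z G n) = 0.
Proof.
rewrite expect_sum; last by move=> i; bounded_mfun_tac.
by rewrite big1// => i _; rewrite expectZl ?E0 ?mulr0//; bounded_mfun_tac.
Qed.

Let B0 : 0 <= B.
Proof. by rewrite mulr_ge0 ?exprn_ge0// sumr_ge0. Qed.

Let QVsym i j : invmx Q i j = invmx Q j i.
Proof. by have [Qs _] := Qpd; rewrite -[in LHS]Qs -trmx_inv mxE. Qed.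

Let om_gt0 : 0 < om.
Proof. exact: posdef_quad_invmx. Qed.

Let ESS_cvg : ESS G / ((N G)%:R * a G) @[G --> \oo] --> om.
Proof.
have -> : om = \sum_i \sum_j alpha i * alpha j * Om i j.
  rewrite /om mxE exchange_big/=; apply: eq_bigr => j _.
  rewrite mxE big_distrl/=; apply: eq_bigr => i _.
  by rewrite /alpha (QVsym j k); ring.
apply: (@cvg_trans _ (\sum_i \sum_j alpha i * alpha j * (v G i j / ((N G)%:R * a G)) @[G --> \oo])).
  apply: near_eq_cvg; near=> G.
  rewrite /ESS (_ : (fun w => _) = (fun w =>
    \sum_i \sum_j alpha i * alpha j * (score G i w * score G j w))); last first.
    apply/funext => w; rewrite SE expr2 big_distrl/=; apply: eq_bigr => i _.
    by rewrite big_distrr/=; apply: eq_bigr => j _; ring.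
  rewrite expect_sum; last by move=> i; bounded_mfun_tac.
  rewrite big_distrl/=; apply: eq_bigr => i _.
  rewrite expect_sum; last by move=> j; bounded_mfun_tac.
  rewrite big_distrl/=; apply: eq_bigr => j _.
  by rewrite expectZl ?mulrA//; bounded_mfun_tac.
apply: cvg_sumf => i; apply: cvg_sumf => j.
by apply: cvgM; [exact: cvg_cst|exact: vOm].
Unshelve. all: by end_near. Qed.

Let ESS_facts : \forall G \near \oo,
  om / 2 * ((N G)%:R * a G) <= ESS G /\ 0 < sig G.
Proof.
have om2 : om / 2 < om by rewrite ltr_pdivrMr// ltr_pMr// ltr1n.
have := @cvgr_gt _ _ _ eventually_filter _ _ ESS_cvg _ om2.
apply: filterS2 rate_facts => G [_ _ _ _ Na0].
rewrite ltr_pdivlMr// => H; split; first exact: ltW.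
by rewrite sqrtr_gt0; apply: le_lt_trans H; rewrite mulr_ge0 ?ltW// divr_gt0.
Qed.

Let stein_cvg (f df : R -> R) (L : R) :
  (forall y : R, is_derive y 1 f (df y)) ->
  (forall y, `|f y| <= L) -> (forall y, `|df y| <= L) ->
  (forall y z, `|df y - df z| <= L * `|y - z|) ->
  expect (P G) (fun w => df (W G w) - W G w * f (W G w)) @[G --> \oo] --> (0 : R).
Proof.
move=> f' fL dfL dfLip.
have L0 : 0 <= L by apply: le_trans (fL 0).
apply/cvgrPdist_le => e e0.
(* Chosen so that [L * th <= e / 2]; the [+ 1] covers [L = 0]. *)
pose th := e / (2 * (L + 1)).
have L10 : 0 < L + 1 by rewrite ltr_wpDl.
have th0 : 0 < th by rewrite divr_gt0// mulr_gt0.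
(* [r1] and [r2] are the two remaining terms of [stein_bound] after [ESS >= om / 2 * (N * a)],
   degree bound [2 * Dl], and [N <= ESS / (om / 2)], which uses [1 <= a]. *)
pose c1 := L * (B ^+ 2 + B ^+ 2) ^+ 2 * 32 / th / (om / 2) ^+ 2.
pose c2 := L * B * (4 * (1 + B ^+ 2 / (om / 2)) + 2 * (B ^+ 2 / (om / 2))).
pose r1 G := c1 * (Dl G ^+ 3 / ((N G)%:R * a G ^+ 2)).
pose r2 G := c2 * Num.sqrt (Dl G ^+ 2 / ((N G)%:R * a G)) / Num.sqrt (om / 2).
have r12 : r1 G + r2 G @[G --> \oo] --> (0 : R).
  rewrite -[X in _ --> X](addr0 0); apply: cvgD.
    by rewrite -[X in _ --> X](mulr0 c1); apply: cvgM rate; exact: cvg_cst.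
  rewrite -[X in _ --> X](mul0r (Num.sqrt (om / 2))^-1); apply: cvgM; last exact: cvg_cst.
  rewrite -[X in _ --> X](mulr0 c2); apply: cvgM; first exact: cvg_cst.
  rewrite -[X in _ --> X]sqrtr0.
  by apply: (continuous_cvg _ _ rate2); exact: sqrt_continuous.
have e20 : 0 < e / 2 by rewrite divr_gt0.
move/cvgrPdist_le/(_ _ e20) : r12 => r12.
near=> G.
have [N0 aG DG aD Na0] :
    [/\ 0 < (N G)%:R :> R, 1 <= a G, 1 <= Dl G, a G <= Dl G & 0 < (N G)%:R * a G].
  by near: G.
have [ESSG sig0] : om / 2 * ((N G)%:R * a G) <= ESS G /\ 0 < sig G by near: G.
have r12G : `|0 - (r1 G + r2 G)| <= e / 2 by near: G.
have sig2 : sig G ^+ 2 = ESS G.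
  by rewrite sqr_sqrtr// ltW// -sqrtr_gt0.
have := stein_bound (dyads G) (mV G) (indep G) (degree G) (kZ G) (ZB G) B0 (EZ G)
  f' fL dfL dfLip sig0 sig2 th0.
rewrite sub0r normrN => /le_trans; apply.
have o20 : 0 < om / 2 by rewrite divr_gt0.
have a0 : 0 < a G by rewrite (lt_le_trans _ aG).
have D0 : 0 < Dl G by rewrite (lt_le_trans _ DG).
have ES0 : 0 < ESS G by rewrite (lt_le_trans _ ESSG)// mulr_gt0.
have LB0 : 0 <= L * B by exact: mulr_ge0 L0 B0.
have bb0 : 0 <= B ^+ 2 / (om / 2) by rewrite divr_ge0 ?sqr_ge0// ltW.
have c20 : 0 <= c2.
  by apply: (mulr_ge0 LB0); apply: addr_ge0; apply: mulr_ge0 => //; apply: addr_ge0.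
have t1 : L * th <= e / 2.
  rewrite (_ : L * th = L / (L + 1) * (e / 2)); last by rewrite /th; field; rewrite gt_eqF.
  by rewrite ler_piMl ?(ltW e20)// ler_pdivrMr// mul1r lerDl.
have t2 : L * ((B ^+ 2 + B ^+ 2) ^+ 2 * (4 * ((N G)%:R * (2 * Dl G) ^+ 3)) /
    sig G ^+ 4 / th) <= r1 G.
  have -> : L * ((B ^+ 2 + B ^+ 2) ^+ 2 * (4 * ((N G)%:R * (2 * Dl G) ^+ 3)) / sig G ^+ 4 / th) =
     L * (B ^+ 2 + B ^+ 2) ^+ 2 * 32 / th * ((N G)%:R * Dl G ^+ 3) * (sig G ^+ 4)^-1.
    by field; rewrite !gt_eqF.
  have -> : r1 G = L * (B ^+ 2 + B ^+ 2) ^+ 2 * 32 / th * ((N G)%:R * Dl G ^+ 3) *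
      ((om / 2 * ((N G)%:R * a G)) ^+ 2)^-1.
    by rewrite /r1 /c1; field; rewrite !gt_eqF.
  apply: ler_wpM2l.
    have thV0 : 0 <= th^-1 by rewrite invr_ge0 ltW.
    have BB0 : 0 <= B ^+ 2 + B ^+ 2 by rewrite addr_ge0 ?sqr_ge0.
    have N0' := ltW N0; have D0' := ltW D0.
    by rewrite !mulr_ge0// exprn_ge0.
  rewrite lef_pV2 ?posrE ?exprn_gt0 ?mulr_gt0//.
  rewrite (_ : sig G ^+ 4 = ESS G ^+ 2); last by rewrite -sig2; ring.
  by rewrite ler_pXn2r ?nnegrE ?(ltW ES0)// ltW// mulr_gt0.
have t3 : L * B * (4 * (max_dyads_of (psi G))%:R * (ESS G + (N G)%:R * B ^+ 2) +
    2 * ((N G)%:R * B ^+ 2)) / sig G ^+ 3 <= r2 G.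
  have Nle : (N G)%:R <= ESS G / (om / 2).
    rewrite ler_pdivlMr// mulrC; apply: le_trans ESSG.
    by rewrite ler_wpM2l ?(ltW o20)// ler_peMr// ltW.
  have NBle : (N G)%:R * B ^+ 2 <= ESS G * (B ^+ 2 / (om / 2)).
    rewrite (_ : ESS G * _ = ESS G / (om / 2) * B ^+ 2); last by ring.
    by rewrite ler_wpM2r ?sqr_ge0.
  have H : 4 * (max_dyads_of (psi G))%:R * (ESS G + (N G)%:R * B ^+ 2) + 2 * ((N G)%:R * B ^+ 2)
     <= ESS G * Dl G * (4 * (1 + B ^+ 2 / (om / 2)) + 2 * (B ^+ 2 / (om / 2))).
    rewrite [leRHS]mulrDr; apply: lerD.
      rewrite (_ : ESS G * _ * _ = 4 * Dl G * (ESS G * (1 + B ^+ 2 / (om / 2)))); last by ring.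
      apply: ler_pM.
      - by rewrite mulr_ge0.
      - by rewrite addr_ge0 ?(ltW ES0)// mulr_ge0 ?sqr_ge0// ltW.
      - by rewrite ler_wpM2l// mDl.
      - by rewrite mulrDr mulr1 lerD2l.
    rewrite (_ : ESS G * _ * _ = Dl G * (2 * (ESS G * (B ^+ 2 / (om / 2))))); last by ring.
    rewrite -[leLHS]mul1r ler_pM//.
      by rewrite mulr_ge0// mulr_ge0 ?sqr_ge0// ltW.
    by rewrite ler_wpM2l.
  have -> : r2 G = c2 * Dl G * (Num.sqrt (om / 2 * ((N G)%:R * a G)))^-1.
    rewrite /r2 [Num.sqrt (om / 2 * _)]sqrtrM ?(ltW o20)//.
    rewrite [Num.sqrt (Dl G ^+ 2 / _)]sqrtrM ?sqr_ge0// sqrtr_sqr gtr0_norm//.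
    by rewrite sqrtrV ?(ltW Na0)// invfM; ring.
  apply: (@le_trans _ _ (L * B * (ESS G * Dl G *
      (4 * (1 + B ^+ 2 / (om / 2)) + 2 * (B ^+ 2 / (om / 2)))) / sig G ^+ 3)).
    rewrite ler_wpM2r ?invr_ge0 ?exprn_ge0 ?(ltW sig0)//.
    by rewrite ler_wpM2l.
  rewrite (_ : L * B * _ / _ = c2 * Dl G * (sig G)^-1); last first.
    by rewrite /c2 -sig2; field; rewrite !gt_eqF.
  apply: ler_wpM2l.
    by apply: mulr_ge0; [exact: c20|exact: ltW].
  rewrite lef_pV2 ?posrE// ?sqrtr_gt0 ?mulr_gt0//.
  by rewrite ler_wsqrtr.
move: r12G; rewrite sub0r normrN => /(le_trans (ler_norm _)) r12G.
rewrite mulrDr; apply: (le_trans (lerD (lerD t1 t2) t3)); lra.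
Unshelve. all: by end_near. Qed.

Lemma score_cdf_near_normal s eta del : 0 < eta -> 0 < del -> \forall G \near \oo,
    fine (P G [set w | W G w <= s]) <= fine (@normal_prob R 0 1 `]-oo, s + eta]) + del /\
    fine (@normal_prob R 0 1 `]-oo, s]) - del <= fine (P G [set w | W G w <= s + eta]).
Proof.
move=> eta0 del0; apply: cdf_near_normal => // G.
by rewrite /W; bounded_mfun_tac.
Qed.

Variable beta : 'cV[R]_K.
Let xcol G w n : 'cV[R]_K := \col_i x G n i w.
Let y G w n : R := dot beta (xcol G w n) + u G n w.
Let A (z : {G & T G}) : 'M[R]_K := \matrix_(i, j) Ahat i j (projT1 z) (projT2 z).
Let H z := invmx (A z).
Let Yv (z : {G & T G}) : 'cV[R]_K := \col_l Y l (projT1 z) (projT2 z).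
Let b (z : {G & T G}) : 'cV[R]_K :=
  ols (xcol (projT1 z) (projT2 z)) (y (projT1 z) (projT2 z)) - beta.
Let Bres (z : {G & T G}) : 'M[R]_K := \matrix_(i, j)
  ((\sum_n \sum_(m | share_unit (psi (projT1 z)) n m)
     residual (xcol (projT1 z) (projT2 z)) (y (projT1 z) (projT2 z)) n
     * residual (xcol (projT1 z) (projT2 z)) (y (projT1 z) (projT2 z)) m
     * xcol (projT1 z) (projT2 z) n i 0 * xcol (projT1 z) (projT2 z) m j 0)
   / ((N (projT1 z))%:R * a (projT1 z))).
Let Vhat (z : {G & T G}) := dyadic_robust_var (psi (projT1 z))
  (xcol (projT1 z) (projT2 z)) (y (projT1 z) (projT2 z)).
Let tstat z := b z k 0 / Num.sqrt (Vhat z k k).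
(** On the good event [b z k 0] is [nu / N * y1 z] and [Vhat z k k] is [(nu / N) ^+ 2 * Rv z], so
    the rate cancels and [tstat z = y1 z / sqrt (Rv z)]; in the same way [W = w1 / rho]. *)
Let y1 z := (H z *m Yv z) k 0.
Let w1 z := (invmx Q *m Yv z) k 0.
Let Rv z := (H z *m Bres z *m H z) k k.
Let rho G := sig G / nu G.

Let mcvgA : mcvg (whp P) A Q.
Proof.
move=> i j; apply: cvg_trans (whp_gram i j).
by apply: near_eq_cvg; near=> z; rewrite mxE.
Unshelve. all: by end_near. Qed.

Let unitA : \forall z \near whp P, A z \in unitmx.
Proof. exact: (mcvg_invmx mcvgA (posdef_unitmx Qpd)).1. Qed.

Let mcvgH : mcvg (whp P) H (invmx Q).
Proof. exact: (mcvg_invmx mcvgA (posdef_unitmx Qpd)).2. Qed.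

Let near_rates : \forall z \near whp P,
  [/\ 0 < (N (projT1 z))%:R :> R, 1 <= a (projT1 z), 1 <= Dl (projT1 z),
    a (projT1 z) <= Dl (projT1 z) & 0 < (N (projT1 z))%:R * a (projT1 z)].
Proof. exact: whp_near rate_facts. Qed.

Let gramA z : 0 < (N (projT1 z))%:R :> R ->
  gram (xcol (projT1 z) (projT2 z)) = (N (projT1 z))%:R *: A z.
Proof.
move=> N0; apply/matrixP => i j; rewrite gramE !mxE /Ahat mulrC divfK ?gt_eqF//.
by apply: eq_bigr => n _; rewrite !mxE.
Qed.

Let gram_unit z : 0 < (N (projT1 z))%:R :> R -> A z \in unitmx ->
  gram (xcol (projT1 z) (projT2 z)) \in unitmx /\
  invmx (gram (xcol (projT1 z) (projT2 z))) = (N (projT1 z))%:R^-1 *: H z.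
Proof.
move=> N0 uA; rewrite gramA//.
have uN : (N (projT1 z))%:R \is a @GRing.unit R by rewrite unitfE gt_eqF.
have ug : (N (projT1 z))%:R *: A z \in unitmx by rewrite unitmxZ.
by split => //; rewrite invmxZ.
Qed.

Let nu_gt0 G : 0 < (N G)%:R * a G -> 0 < nu G.
Proof. by move=> Na0; rewrite sqrtr_gt0. Qed.

Let bE z : 0 < (N (projT1 z))%:R * a (projT1 z) -> 0 < (N (projT1 z))%:R :> R ->
  A z \in unitmx -> b z = (nu (projT1 z) / (N (projT1 z))%:R) *: (H z *m Yv z).
Proof.
move=> Na0 N0 uA; have [ug gV] := gram_unit z N0 uA.
rewrite /b (ols_error (fun=> erefl))// addrC addKr gV.
have -> : \sum_n u (projT1 z) n (projT2 z) *: xcol (projT1 z) (projT2 z) n =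
   nu (projT1 z) *: Yv z.
  apply/colP => i; rewrite summxE !mxE /Y mulrC divfK ?gt_eqF ?nu_gt0//.
  by apply: eq_bigr => n _; rewrite !mxE.
by rewrite -scalemxAr -scalemxAl scalerA.
Qed.

(* [invmx A - invmx Q = invmx A (Q - A) invmx Q], and the entries of [Q - A] times
   the bounded-in-probability [Yv] vanish. *)
Let y1w1 : y1 z - w1 z @[z --> whp P] --> (0 : R).
Proof.
pose D z := (Q - A z) *m (invmx Q *m Yv z).
have mD : mcvg (whp P) D 0.
  move=> i j; rewrite mxE.
  suff : \sum_l \sum_m - (invmx Q l m) * at_sample (fun G w => (Ahat i l G w - Q i l) * Y m G w) z
      @[z --> whp P] --> (0 : R).
    apply: cvg_trans; apply: near_eq_cvg; near=> z.
    rewrite /D !mxE; apply: eq_bigr => l _; rewrite !mxE big_distrr/=.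
    by apply: eq_bigr => m _; rewrite !mxE /at_sample; ring.
  rewrite [X in _ --> X](_ : _ = \sum_(l < K) \sum_(m < K) - (invmx Q l m) * 0); last first.
    by rewrite big1// => l _; rewrite big1// => m _; rewrite mulr0.
  apply: cvg_sumf => l; apply: cvg_sumf => m.
  by apply: cvgM; [exact: cvg_cst|exact: whp_gram_score].
have mHD : mcvg (whp P) (fun z => H z *m D z) (invmx Q *m 0).
  exact: mcvg_mulmx mcvgH mD.
have := mHD k 0; rewrite mulmx0 mxE.
apply: cvg_trans; apply: near_eq_cvg; near=> z.
have uA : A z \in unitmx by near: z.
have uQ := posdef_unitmx Qpd.
rewrite /y1 /w1 /D mulmxA mulmxBr [H z *m A z]mulVmx// mulmxBl -!mulmxA.
by rewrite mulKVmx// mul1mx !mxE.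
Unshelve. all: by end_near. Qed.

Let kb_small i : kap (projT1 z) * b z i 0 @[z --> whp P] --> (0 : R).
Proof.
suff : \sum_j H z i j * at_sample (fun G w => kap G * (nu G / (N G)%:R) * Y j G w) z
    @[z --> whp P] --> (0 : R).
  apply: cvg_trans; apply: near_eq_cvg; near=> z.
  have uA : A z \in unitmx by near: z.
  have [N0 _ _ _ Na0] : [/\ 0 < (N (projT1 z))%:R :> R, 1 <= a (projT1 z), 1 <= Dl (projT1 z),
    a (projT1 z) <= Dl (projT1 z) & 0 < (N (projT1 z))%:R * a (projT1 z)] by near: z.
  rewrite bE// !mxE !big_distrr/=; apply: eq_bigr => j _.
  by rewrite !mxE /at_sample; ring.
rewrite [X in _ --> X](_ : _ = \sum_(j < K) invmx Q i j * 0); last first.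
  by rewrite big1// => j _; rewrite mulr0.
by apply: cvg_sumf => j; apply: cvgM; [exact: mcvgH|exact: whp_score_small].
Unshelve. all: by end_near. Qed.

Let kb_norm : kap (projT1 z) * (\sum_l `|b z l 0|) @[z --> whp P] --> (0 : R).
Proof.
rewrite [X in _ --> X](_ : _ = \sum_(l < K) 0); last by rewrite big1.
suff : \sum_l `|kap (projT1 z) * b z l 0| @[z --> whp P] --> \sum_(l < K) (0 : R).
  apply: cvg_trans; apply: near_eq_cvg; near=> z.
  have [_ a1z D1z aD _] : [/\ 0 < (N (projT1 z))%:R :> R, 1 <= a (projT1 z), 1 <= Dl (projT1 z),
    a (projT1 z) <= Dl (projT1 z) & 0 < (N (projT1 z))%:R * a (projT1 z)] by near: z.
  rewrite big_distrr/=; apply: eq_bigr => l _; rewrite normrM; congr (_ * _).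
  by rewrite ger0_norm// divr_ge0// (le_trans ler01).
by apply: cvg_sumf => l; apply: cvg_norm0; exact: kb_small.
Unshelve. all: by end_near. Qed.

Let mcvgB : mcvg (whp P) Bres Om.
Proof.
move=> i j.
have dB : Bres z i j - at_sample (Bhat i j) z @[z --> whp P] --> (0 : R).
  (* After division by [N * a] the bound of [meat_error] contains [kap * b] and [kap * b ^+ 2]; the
     latter is at most [(kap * b) ^+ 2] because [1 <= kap]. *)
  pose g z := kap (projT1 z) * (\sum_l `|b z l 0|).
  apply: (@cvg_le0 _ _ _ _ _ (fun z => 2 * C ^+ 4 * (2 * g z + g z * g z))); last first.
    rewrite -[X in _ --> X](mulr0 (2 * C ^+ 4)); apply: cvgM; first exact: cvg_cst.
    rewrite -[X in _ --> X](addr0 0); apply: cvgD.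
      by rewrite -[X in _ --> X](mulr0 2); apply: cvgM; [exact: cvg_cst|exact: kb_norm].
    by rewrite -[X in _ --> X](mulr0 0); apply: cvgM; exact: kb_norm.
  near=> z.
  have [N0 a1z D1z aD Na0] : [/\ 0 < (N (projT1 z))%:R :> R, 1 <= a (projT1 z), 1 <= Dl (projT1 z),
    a (projT1 z) <= Dl (projT1 z) & 0 < (N (projT1 z))%:R * a (projT1 z)] by near: z.
  have a0 : 0 < a (projT1 z) by rewrite (lt_le_trans _ a1z).
  have k1 : 1 <= kap (projT1 z) by rewrite ler_pdivlMr// mul1r.
  have k0 : 0 <= kap (projT1 z) by rewrite (le_trans ler01).
  have xC' n l : `|xcol (projT1 z) (projT2 z) n l 0| <= C by rewrite mxE.
  have := meat_error (psi := psi (projT1 z)) (fun=> erefl) i j xC'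
    (fun n => uC (projT1 z) n (projT2 z)) (degree (projT1 z)) (erefl (\sum_l `|b z l 0|)).
  set bb := \sum_l `|b z l 0| => Herr.
  have bb0 : 0 <= bb by rewrite sumr_ge0.
  rewrite mxE /at_sample /Bhat -mulrBl normrM [`|_^-1|]gtr0_norm ?invr_gt0//.
  rewrite ler_pdivrMr//.
  have -> : \sum_n \sum_(m | share_unit (psi (projT1 z)) n m)
      u (projT1 z) n (projT2 z) * u (projT1 z) m (projT2 z) *
      x (projT1 z) n i (projT2 z) * x (projT1 z) m j (projT2 z)
    = \sum_n \sum_(m | share_unit (psi (projT1 z)) n m)
      u (projT1 z) n (projT2 z) * u (projT1 z) m (projT2 z) *
      xcol (projT1 z) (projT2 z) n i 0 * xcol (projT1 z) (projT2 z) m j 0.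
    by apply: eq_bigr => n _; apply: eq_bigr => m _; rewrite !mxE.
  apply: (le_trans Herr).
  have -> : 2 * C ^+ 4 * (2 * g z + g z * g z) * ((N (projT1 z))%:R * a (projT1 z)) =
     (N (projT1 z))%:R * (2 * Dl (projT1 z)) * (C ^+ 4 * (2 * bb + kap (projT1 z) * bb ^+ 2)).
    by rewrite /g -/bb /kap; field; rewrite gt_eqF.
  apply: ler_wpM2l; first by rewrite mulr_ge0 ?(ltW N0)// mulr_ge0// (le_trans ler01).
  apply: ler_wpM2l; first by rewrite exprn_ge0.
  by rewrite lerD2l ler_peMl ?sqr_ge0.
rewrite -[X in _ --> X]add0r.
apply: cvg_trans (cvgD dB (whp_meat i j)).
by apply: near_eq_cvg; near=> z; rewrite subrK.
Unshelve. all: by end_near. Qed.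

Let Rv_cvg : Rv z @[z --> whp P] --> om.
Proof. exact: mcvg_mulmx (mcvg_mulmx mcvgH mcvgB) mcvgH k k. Qed.

Let VhatE z : 0 < (N (projT1 z))%:R * a (projT1 z) -> 0 < (N (projT1 z))%:R :> R ->
  A z \in unitmx -> Vhat z k k = (nu (projT1 z) / (N (projT1 z))%:R) ^+ 2 * Rv z.
Proof.
move=> Na0 N0 uA; have [ug gV] := gram_unit z N0 uA.
rewrite /Vhat /dyadic_robust_var gV.
set M := \sum_n _.
have -> : M = ((N (projT1 z))%:R * a (projT1 z)) *: Bres z.
  by apply/matrixP => i j; rewrite /M meatE !mxE mulrC divfK// gt_eqF.
rewrite -!scalemxAl -!scalemxAr -scalemxAl !scalerA mxE; congr (_ * _).
by rewrite expr_div_n /nu sqr_sqrtr ?(ltW Na0)//; field; rewrite gt_eqF.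
Qed.

Let rho_cvg : rho (projT1 z) @[z --> whp P] --> Num.sqrt om.
Proof.
apply: (@whp_cvg _ _ _ P rho).
have : Num.sqrt (ESS G / ((N G)%:R * a G)) @[G --> \oo] --> Num.sqrt om.
  by apply: (continuous_cvg _ _ ESS_cvg); exact: sqrt_continuous.
apply: cvg_trans; apply: near_eq_cvg; apply: filterS rate_facts => G [_ _ _ _ Na0].
rewrite sqrtrM ?sqrtrV ?(ltW Na0)//.
by apply: expect_ge0 => w; exact: sqr_ge0.
Qed.

Let WE z : 0 < (N (projT1 z))%:R * a (projT1 z) ->
  W (projT1 z) (projT2 z) = w1 z / rho (projT1 z).
Proof.
move=> Na0; rewrite /W SE /w1 mxE /rho invfM invrK mulrC [RHS]mulrC -mulrA.
congr (_ * _); rewrite big_distrr/=; apply: eq_bigr => i _.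
by rewrite [Yv z i 0]mxE /Y /alpha; field; rewrite gt_eqF// nu_gt0.
Qed.

(** Slutsky's theorem as a comparison of events: [y1 - w1] vanishes and both denominators tend to
    [sqrt om], so a margin [eta] in the threshold absorbs all differences. *)
Lemma tstat_sandwich s eta : 0 < eta -> \forall z \near whp P,
  [/\ gram (xcol (projT1 z) (projT2 z)) \in unitmx, 0 < Vhat z k k,
    tstat z <= s -> W (projT1 z) (projT2 z) <= s + eta &
    W (projT1 z) (projT2 z) <= s - eta -> tstat z <= s].
Proof.
move=> eta0.
have som0 : 0 < Num.sqrt om by rewrite sqrtr_gt0.
have sR : Num.sqrt (Rv z) @[z --> whp P] --> Num.sqrt om.
  by apply: (continuous_cvg _ _ Rv_cvg); exact: sqrt_continuous.
have es0 : 0 < eta * Num.sqrt om by rewrite mulr_gt0.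
(* If [y1 <= s * sqrt Rv], positivity of this quantity gives [w1 <= (s + eta) * rho]. Its limit is
   [eta * sqrt om > 0]; the next quantity does the same for the converse inclusion. *)
have d1 : \forall z \near whp P,
    0 < (s + eta) * rho (projT1 z) - s * Num.sqrt (Rv z) + (y1 z - w1 z).
  apply: (@cvg_gt0_near _ _ _ _ _ (eta * Num.sqrt om)) => //.
  rewrite (_ : eta * _ = (s + eta) * Num.sqrt om - s * Num.sqrt om + 0); last by ring.
  by apply: cvgD y1w1; apply: cvgB; apply: cvgM => //; exact: cvg_cst.
have d2 : \forall z \near whp P,
    0 < s * Num.sqrt (Rv z) - (s - eta) * rho (projT1 z) - (y1 z - w1 z).
  apply: (@cvg_gt0_near _ _ _ _ _ (eta * Num.sqrt om)) => //.
  rewrite (_ : eta * _ = s * Num.sqrt om - (s - eta) * Num.sqrt om - 0); last by ring.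
  by apply: cvgB y1w1; apply: cvgB; apply: cvgM => //; exact: cvg_cst.
have R0 : \forall z \near whp P, 0 < Rv z by exact: cvg_gt0_near Rv_cvg om_gt0.
have rho0 : \forall z \near whp P, 0 < rho (projT1 z).
  exact: cvg_gt0_near rho_cvg som0.
near=> z.
have uA : A z \in unitmx by near: z.
have [N0 _ _ _ Na0] : [/\ 0 < (N (projT1 z))%:R :> R, 1 <= a (projT1 z), 1 <= Dl (projT1 z),
    a (projT1 z) <= Dl (projT1 z) & 0 < (N (projT1 z))%:R * a (projT1 z)] by near: z.
have R0z : 0 < Rv z by near: z.
have rho0z : 0 < rho (projT1 z) by near: z.
have nN0 : 0 < nu (projT1 z) / (N (projT1 z))%:R by rewrite divr_gt0// nu_gt0.
have tE : tstat z = y1 z / Num.sqrt (Rv z).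
  rewrite /tstat bE// VhatE// sqrtrM ?sqr_ge0// sqrtr_sqr gtr0_norm// [_ k 0]mxE -/(y1 z).
  by rewrite -mulf_div divff ?mul1r// gt_eqF.
have sR0 : 0 < Num.sqrt (Rv z) by rewrite sqrtr_gt0.
have d1z : 0 < (s + eta) * rho (projT1 z) - s * Num.sqrt (Rv z) + (y1 z - w1 z) by near: z.
have d2z : 0 < s * Num.sqrt (Rv z) - (s - eta) * rho (projT1 z) - (y1 z - w1 z) by near: z.
split.
- exact: (gram_unit z N0 uA).1.
- by rewrite VhatE// mulr_gt0// exprn_gt0.
- by rewrite tE WE// !ler_pdivrMr// => h; lra.
- by rewrite tE WE// !ler_pdivrMr// => h; lra.
Unshelve. all: by end_near. Qed.

(** Measurability rests on [t]; [tstat] enters only through inclusions valid on a measurable set of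
    high probability. *)
Lemma tstat_cdf (t : forall G, T G -> R) (mt : forall G, measurable_fun setT (t G)) :
  (forall G, {ae P G, forall w, gram (xcol G w) \in unitmx ->
    0 < Vhat (existT _ G w) k k -> t G w = tstat (existT _ G w)}) ->
  forall s eta del, 0 < eta -> 0 < del -> \forall G \near \oo,
    fine (P G [set w | t G w <= s]) <= fine (@normal_prob R 0 1 `]-oo, s + eta]) + del /\
    fine (@normal_prob R 0 1 `]-oo, s - eta]) - del <= fine (P G [set w | t G w <= s]).
Proof.
move=> aet s eta del eta0 del0.
(* Half of [eta] and [del] pays for passing from [t] to [W], the other half for the normal
   approximation of [W]. *)
have eta20 : 0 < eta / 2 by rewrite divr_gt0.
have del20 : 0 < del / 2 by rewrite divr_gt0.
have mle G (X : T G -> R) c : measurable_fun setT X -> measurable [set w | X w <= c].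
  move=> mX; rewrite [X in measurable X](_ : _ = setT `&` X @^-1` `]-oo, c]); last first.
    by apply/seteqP; split => w /=; rewrite in_itv/=; [split|case].
  exact: mX.
have mW G : measurable_fun setT (W G).
  by have [] : bounded_mfun (W G) by rewrite /W; bounded_mfun_tac.
have : \forall z \near whp P,
    (t (projT1 z) (projT2 z) <= s -> W (projT1 z) (projT2 z) <= s + eta / 2) /\
    (W (projT1 z) (projT2 z) <= s - eta / 2 -> t (projT1 z) (projT2 z) <= s).
  have sand := tstat_sandwich s (eta / 2) eta20.
  have aet' := whp_ae aet.
  near=> z.
  have [ug V0 h1 h2] : [/\ gram (xcol (projT1 z) (projT2 z)) \in unitmx, 0 < Vhat z k k,
    tstat z <= s -> W (projT1 z) (projT2 z) <= s + eta / 2 &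
    W (projT1 z) (projT2 z) <= s - eta / 2 -> tstat z <= s] by near: z.
  have tE : gram (xcol (projT1 z) (projT2 z)) \in unitmx ->
    0 < Vhat (existT _ (projT1 z) (projT2 z)) k k ->
    t (projT1 z) (projT2 z) = tstat (existT _ (projT1 z) (projT2 z)) by near: z.
  have zE : existT (fun G => T G) (projT1 z) (projT2 z) = z by case: (z).
  by rewrite zE in tE; rewrite tE.
move=> /(_ _ del20) sandwich.
have up := score_cdf_near_normal (s + eta / 2) (eta / 2) (del / 2) eta20 del20.
have lo := score_cdf_near_normal (s - eta) (eta / 2) (del / 2) eta20 del20.
apply: filterS3 sandwich up lo => G [E [mE PE HE]] [up _] [_ lo].
have split_le (X X' : T G -> R) c c' : measurable_fun setT X -> measurable_fun setT X' ->
    (forall w, E w -> X w <= c -> X' w <= c') ->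
    fine (P G [set w | X w <= c]) <= fine (P G [set w | X' w <= c']) + del / 2.
  move=> mX mX' XX'.
  have m1 : measurable [set w | X w <= c] by exact: mle.
  have m2 : measurable [set w | X' w <= c'] by exact: mle.
  apply: (@le_trans _ _ (fine (P G ([set w | X' w <= c'] `|` ~` E)))).
    rewrite fine_le ?fin_num_measure//; first exact: measurableU (measurableC mE).
    apply: le_measure; rewrite ?inE//; first exact: measurableU (measurableC mE).
    move=> w /= Xw; have [Ew|nEw] := pselect (E w); [left|by right].
    exact: XX'.
  apply: (le_trans (fine_prob_setU _ _ _)) => //; first exact: measurableC.
  by rewrite lerD2l.
split.
- have : fine (P G [set w | t G w <= s]) <= fine (P G [set w | W G w <= s + eta / 2]) + del / 2.
    by apply: split_le => // w Ew; exact: (HE w Ew).1.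
  rewrite (_ : s + eta / 2 + eta / 2 = s + eta) in up; last by lra.
  lra.
- have : fine (P G [set w | W G w <= s - eta / 2]) <= fine (P G [set w | t G w <= s]) + del / 2.
    by apply: split_le => // w Ew; exact: (HE w Ew).2.
  rewrite (_ : s - eta + eta / 2 = s - eta / 2) in lo; last by lra.
  lra.
Unshelve. all: by end_near. Qed.

End asymptotics.

(** * Truncation, convergence in distribution and the three regimes *)

Set Implicit Arguments.

(** Makes moments comparable across sample spaces, so that a single matrix [Q] serves all dyads and
    all [G]. *)
Lemma expect_law (R : realType) d1 d2 d' (T1 : measurableType d1) (T2 : measurableType d2)
    (T' : measurableType d') (P1 : probability T1 R) (P2 : probability T2 R)
    (Z1 : T1 -> T') (Z2 : T2 -> T') (g : T' -> R) :
  measurable_fun setT Z1 -> measurable_fun setT Z2 -> bounded_mfun g ->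
  (forall A, measurable A -> P1 (Z1 @^-1` A) = P2 (Z2 @^-1` A)) ->
  expect P1 (g \o Z1) = expect P2 (g \o Z2).
Proof.
move=> mZ1 mZ2 [mg [C gC]] law; congr fine.
have i1 : P1.-integrable setT ((EFin \o g) \o Z1).
  apply: (bounded_mfun_integrable P1 (X := g \o Z1)).
  by split; [exact: measurableT_comp|exists C => w; exact: gC].
have i2 : P2.-integrable setT ((EFin \o g) \o Z2).
  apply: (bounded_mfun_integrable P2 (X := g \o Z2)).
  by split; [exact: measurableT_comp|exists C => w; exact: gC].
have mEg : measurable_fun setT (EFin \o g) by exact/measurable_EFinP.
pose Z1' : {mfun T1 >-> T'} := HB.pack Z1 (isMeasurableFun.Build _ _ _ _ Z1 mZ1).
pose Z2' : {mfun T2 >-> T'} := HB.pack Z2 (isMeasurableFun.Build _ _ _ _ Z2 mZ2).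
rewrite -[LHS](@integral_distribution _ _ _ _ _ P1 Z1' (EFin \o g) mEg i1).
rewrite -[RHS](@integral_distribution _ _ _ _ _ P2 Z2' (EFin \o g) mEg i2).
by apply: eq_measure_integral => A mA _; exact: law.
Qed.

Section clip.
Context (R : realType) (C : R).
Hypothesis C0 : 0 <= C.

(** A fixed measurable function of the value: clipped variables stay measurable for their own dyad
    and equal laws remain equal, so independence and identical distribution carry over. *)
Definition clip (z : R) : R := Num.max (- C) (Num.min C z).

Lemma clip_id z : `|z| <= C -> clip z = z.
Proof.
by rewrite ler_norml /clip => /andP[z1 z2]; rewrite (min_idPr z2) (max_idPr z1).
Qed.

Lemma clip_bound z : `|clip z| <= C.
Proof.
by rewrite ler_norml /clip le_max lexx/= ge_max ge_min lexx/= andbT (le_trans _ C0)// oppr_le0.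
Qed.

Lemma measurable_clip : measurable_fun setT clip.
Proof. by apply: measurable_maxr => //; exact: measurable_minr. Qed.

End clip.

Lemma coord_le_euclidean_norm (R : realType) K (b : 'cV[R]_K) i :
  `|b i 0| <= euclidean_norm b.
Proof.
rewrite /euclidean_norm -sqrtr_sqr ler_wsqrtr// dotE (bigD1 i)//= -expr2 lerDl.
by apply: sumr_ge0 => j _; rewrite -expr2 sqr_ge0.
Qed.

Lemma invr_natr_powR_cvg0 (R : realType) (p : R) : 0 < p ->
  (G%:R `^ p)^-1 @[G --> \oo] --> (0 : R).
Proof.
move=> p0; apply/gtr0_cvgV0.
  near=> G; rewrite powR_gt0// ltr0n; near: G; exact: nbhs_infty_gt.
apply/cvgryPge => M.
have /cvgryPge/(_ (Num.max M 0 `^ p^-1)) := @cvgr_idn R.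
apply: filterS => G MG.
have M0 : 0 <= Num.max M 0 by rewrite le_max lexx orbT.
apply: (@le_trans _ _ (Num.max M 0)); first by rewrite le_max lexx.
have -> : Num.max M 0 = (Num.max M 0 `^ p^-1) `^ p.
  by rewrite -powRrM mulVf ?lt0r_neq0// powRr1.
by apply: ge0_ler_powR => //; rewrite ?nnegrE ?powR_ge0// ltW.
Unshelve. all: by end_near. Qed.

(** Summing the degrees over the [G] units counts every dyad twice. *)
Lemma dyads_lower_bound (R : realType) G N (psi : 'I_N -> {set 'I_G}) (c : R) :
  dyad_enumeration psi -> c * G%:R <= (min_dyads_of psi)%:R ->
  c / 2 * G%:R ^+ 2 <= N%:R.
Proof.
move=> dyads cG.
suff : c * G%:R * G%:R <= 2 * N%:R :> R by rewrite expr2 mulrA; lra.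
apply: (@le_trans _ _ ((min_dyads_of psi)%:R * G%:R)); first by rewrite ler_wpM2r.
rewrite -!natrM ler_nat -(sum_dyads_of dyads) mulnC -[X in (X * _)%N]card_ord -sum_nat_const.
by apply: leq_sum => g _; exact: min_dyads_of_le.
Qed.

Lemma max_dyads_of_le G N (psi : 'I_N -> {set 'I_G}) :
  dyad_enumeration psi -> (max_dyads_of psi <= G)%N.
Proof. by move=> dyads; apply/bigmax_leqP => g _; exact: dyads_of_le. Qed.

Lemma mcvg_entries (R : realType) K (A : nat -> 'M[R]_K) (Om : 'M[R]_K) :
  A G @[G --> \oo] --> Om -> forall i j, A G i j @[G --> \oo] --> Om i j.
Proof.
move=> AO i j.
exact: (cvg_comp A (fun M : 'M[R]_K => M i j) AO (@coord_continuous R K K i j Om)).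
Qed.

(** Continuity of the limit distribution function at [s] absorbs the slack [eta] left by smoothing
    and by Slutsky's argument. *)
Lemma cvg_in_distribution_squeeze (R : realType) (d : nat -> measure_display)
    (T : forall G, measurableType (d G)) (P : forall G, probability (T G) R)
    (X : forall G, {RV P G >-> R}) (mu : probability (measurableTypeR R) R) :
  (forall s eta del, 0 < eta -> 0 < del -> \forall G \near \oo,
    fine (P G [set w | X G w <= s]) <= fine (mu `]-oo, s + eta]%classic) + del /\
    fine (mu `]-oo, s - eta]%classic) - del <= fine (P G [set w | X G w <= s])) ->
  cvg_in_distribution X mu.
Proof.
move=> H s cs.
have fmu (a : R) : mu `]-oo, a]%classic \is a fin_num by exact: fin_num_measure.
have cfE G : fine (cdf (X G) s) = fine (P G [set w | X G w <= s]).
  rewrite (_ : [set w | X G w <= s] = X G @^-1` `]-oo, s]%classic)//.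
rewrite -(fineK (fmu s)); apply/fine_cvgP; split.
  by near=> G; exact: fin_num_measure.
have /fine_cvg cs' : mu `]-oo, a]%classic @[a --> s] --> (fine (mu `]-oo, s]%classic))%:E.
  by rewrite fineK//; exact: cs.
apply/cvgrPdist_le => e e0.
have e20 : 0 < e / 2 by rewrite divr_gt0.
move/cvgrPdist_le : cs' => /(_ _ e20)[eta /= eta0 He].
have eta20 : 0 < eta / 2 by rewrite divr_gt0.
apply: filterS (H s _ _ eta20 e20) => G /= [up lo].
have up' := He (s + eta / 2); have lo' := He (s - eta / 2).
rewrite cfE.
have : `|fine (mu `]-oo, s]%classic) - fine (mu `]-oo, s + eta / 2]%classic)| <= e / 2.
  by apply: up'; rewrite /= opprD addrA subrr add0r normrN gtr0_norm//; lra.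
have : `|fine (mu `]-oo, s]%classic) - fine (mu `]-oo, s - eta / 2]%classic)| <= e / 2.
  by apply: lo'; rewrite /= opprB addrC subrK gtr0_norm//; lra.
rewrite !ler_norml => /andP[h1 h2] /andP[h3 h4]; apply/andP; split; lra.
Unshelve. all: by end_near. Qed.

Lemma ae_forall_ord (R : realType) d (T : measurableType d) (P : probability T R) n
    (Q : 'I_n -> T -> Prop) :
  (forall i, {ae P, forall w, Q i w}) -> {ae P, forall w, forall i, Q i w}.
Proof.
move=> aeQ.
have : {ae P, forall w, forall m : nat, forall h : (m < n)%N, Q (Ordinal h) w}.
  apply/ae_foralln => m.
  have /orP[mn|nm] : ((m < n) || (n <= m))%N by case: ltnP.
    by apply: filterS (aeQ (Ordinal mn)) => w Qw h; rewrite (bool_irrelevance h mn).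
  by apply: nearW => w h; move: nm; rewrite leqNgt h.
by apply: filterS => w Qw [m h]; exact: Qw.
Qed.

Theorem theorem3p1 (R : realType) (K : nat)
    (d : nat -> measure_display) (T : forall G, measurableType (d G))
    (P : forall G, probability (T G) R)
    (N : nat -> nat) (psi : forall G, 'I_(N G) -> {set 'I_G})
    (x : forall G, 'I_(N G) -> {RV P G >-> K.-tuple R})
    (u : forall G, 'I_(N G) -> {RV P G >-> R})
    (y : forall G, 'I_(N G) -> T G -> R)
    (beta : 'cV[R]_K)
    (xv := fun G n w => vec (x G n w))
    (xu := fun G n w => (x G n w, u G n w))
    (score_sum := fun G w => \sum_n u G n w *: xv G n w)
    (dyads : forall G, dyad_enumeration (psi G))
    (N_infty : N G @[G --> \oo] --> \oo)
    (model : forall G n w, y G n w = dot beta (xv G n w) + u G n w)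
    (exogeneity : forall G n,
      mean_mx (P G) (fun w => u G n w *: xv G n w) = 0)
    (full_rank : forall G n,
      posdef (mean_mx (P G) (fun w => xv G n w *m (xv G n w)^T)))
    (identically_distributed : forall G n G' n' (A : set (K.-tuple R * R)),
      measurable A -> P G (xu G n @^-1` A) = P G' (xu G' n' @^-1` A))
    (dyadic_dependence : forall G (S1 S2 : {set 'I_(N G)}),
      [disjoint S1 & S2]%B ->
      (forall n m, n \in S1 -> m \in S2 -> ~~ share_unit (psi G) n m) ->
      independent_subfamilies (P G) (xu G) S1 S2)
    (bounded_support : exists C : R, forall G n,
      {ae P G, forall w, euclidean_norm (xv G n w) <= C /\ `|u G n w| <= C})
    (* a dyad needs two units, so [G] ranges over [2 <= G] in the lower bounds *)
    (regimes :
      [\/ (exists D : R, forall G, (max_dyads_of (psi G))%:R < D) /\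
          posdef_limit (fun G =>
            (N G)%:R^-1 *: var_mx (P G) (score_sum G)),
          (exists2 c : R, 0 < c &
            forall G, (2 <= G)%N -> c * G%:R <= (min_dyads_of (psi G))%:R) /\
          posdef_limit (fun G =>
            ((N G)%:R * G%:R)^-1 *: var_mx (P G) (score_sum G))
        | (exists2 c : R, 0 < c &
            forall G, (2 <= G)%N -> c * G%:R <= (min_dyads_of (psi G))%:R) /\
          exists r : R, [/\ 0 <= r <= 1, 1 / 2 < r &
            posdef_limit (fun G =>
              ((N G)%:R * (G%:R `^ r))^-1 *: var_mx (P G) (score_sum G))]])
    (k : 'I_K)
    (beta_hat := fun G w => ols (xv G ^~ w) (y G ^~ w))
    (V_hat := fun G w => dyadic_robust_var (psi G) (xv G ^~ w) (y G ^~ w))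
    (* the t-statistic is an arbitrary random variable off the good event *)
    (t : forall G, {RV P G >-> R})
    (tE : forall G w, gram (xv G ^~ w) \in unitmx -> 0 < V_hat G w k k ->
      t G w = (beta_hat G w k 0 - beta k 0) / Num.sqrt (V_hat G w k k)) :
  cvg_in_distribution t (normal_prob 0 1).
Proof.
have [C bnd] := bounded_support.
(* [C] comes without a sign, while clipping at [B] is bounded by [B] only for [0 <= B]. *)
pose B := `|C|; have B0 : 0 <= B by exact: normr_ge0.
have eq_vec G n w i : xv G n w i 0 = tnth (x G n w) i by rewrite mxE.
(* Clipping turns the almost sure bounds into everywhere bounds while changing the
   sample only on a null set. *)
pose x' G n i w := clip B (tnth (x G n w) i).
pose u' G n w := clip B (u G n w).
have mx G (n : 'I_(N G)) i : measurable_fun setT (fun w => tnth (x G n w) i).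
  by apply: (measurableT_comp (measurable_tnth i)); exact: measurable_funPT.
have mu' G (n : 'I_(N G)) : measurable_fun setT (u G n) by exact: measurable_funPT.
have mxu G (n : 'I_(N G)) : measurable_fun setT (xu G n).
  by apply: measurable_fun_pair; exact: measurable_funPT.
have aeE G : {ae P G, forall w, forall n,
    (forall i, x' G n i w = tnth (x G n w) i) /\ u' G n w = u G n w}.
  apply: ae_forall_ord => n; apply: filterS (bnd G n) => w [xC uC]; split.
    move=> i; apply: clip_id; rewrite -eq_vec.
    by rewrite (le_trans (coord_le_euclidean_norm _ _))// (le_trans xC)// ler_norm.
  by apply: clip_id; rewrite (le_trans uC)// ler_norm.
pose gx i (z : K.-tuple R * R) := clip B (tnth z.1 i).
pose gu (z : K.-tuple R * R) := clip B z.2.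
have bgx i : bounded_mfun (gx i).
  split; last by exists B => z; exact: clip_bound.
  apply: (measurableT_comp (measurable_clip B)).
  by apply: (measurableT_comp (measurable_tnth i)); exact: measurable_fst.
have bgu : bounded_mfun gu.
  split; last by exists B => z; exact: clip_bound.
  by apply: (measurableT_comp (measurable_clip B)); exact: measurable_snd.
have kx G (n : 'I_(N G)) i : known (xu G) [set n]%SET (x' G n i).
  apply: (@known_comp _ _ _ _ _ _ _ [set n]%SET n (gx i)); first by rewrite inE.
    by have [] := bgx i.
  by have [] := bgx i.
have ku G (n : 'I_(N G)) : known (xu G) [set n]%SET (u' G n).
  apply: (@known_comp _ _ _ _ _ _ _ [set n]%SET n gu); first by rewrite inE.
    by have [] := bgu.
  by have [] := bgu.
have bx G (n : 'I_(N G)) i : bounded_mfun (x' G n i).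
  exact: known_bounded_mfun (mxu G) _ _ (kx G n i).
have bu G (n : 'I_(N G)) : bounded_mfun (u' G n) by exact: known_bounded_mfun (mxu G) _ _ (ku G n).
(* Some dyad exists because [N] is unbounded; its law serves as the common one, so that [Q] does not
   depend on [G]. *)
have [G0 [n0 _]] : exists G0, exists n0 : 'I_(N G0), True.
  have : \forall G \near \oo, (0 < N G)%N.
    by move: N_infty => /(_ [set m | 0 < m]%N); apply; exact: nbhs_infty_gt.
  by move=> [G0 _ /(_ G0 (leqnn _))] NG0; exists G0, (Ordinal NG0).
pose Q := mean_mx (P G0) (fun w => xv G0 n0 w *m (xv G0 n0 w)^T).
have EQ G (n : 'I_(N G)) i j : expect (P G) (fun w => x' G n i w * x' G n j w) = Q i j.
  have -> : expect (P G) (fun w => x' G n i w * x' G n j w) =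
      expect (P G0) (fun w => x' G0 n0 i w * x' G0 n0 j w).
    apply: (@expect_law _ _ _ _ _ _ _ (P G) (P G0) (xu G n) (xu G0 n0)
      (fun z => gx i z * gx j z)) => //.
      by apply: bounded_mfunM.
    by move=> A mA; exact: identically_distributed.
  rewrite /Q mxE unlock; apply: expect_ae.
  - by have [] := bounded_mfunM (bx G0 n0 i) (bx G0 n0 j).
  - rewrite (_ : (fun w => _) = (fun w => tnth (x G0 n0 w) i * tnth (x G0 n0 w) j)).
      exact: measurable_funM.
    by apply/funext => w; rewrite mxE big_ord1 !mxE.
  - by apply: filterS (aeE G0) => w /(_ n0)[xE _]; rewrite mxE big_ord1 !mxE !xE.
have E0 G (n : 'I_(N G)) i : expect (P G) (fun w => u' G n w * x' G n i w) = 0.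
  have := exogeneity G n => /matrixP/(_ i 0); rewrite !mxE unlock => <-.
  apply: expect_ae.
  - by have [] := bounded_mfunM (bu G n) (bx G n i).
  - rewrite (_ : (fun w => _) = (fun w => u G n w * tnth (x G n w) i)).
      exact: measurable_funM.
    by apply/funext => w; rewrite !mxE.
  - by apply: filterS (aeE G) => w /(_ n)[xE uE]; rewrite !mxE xE uE.
pose sc' G i w := \sum_n u' G n w * x' G n i w.
have bsc G i : bounded_mfun (sc' G i) by rewrite /sc'; bounded_mfun_tac.
have scE G w i : score_sum G w i 0 = \sum_n u G n w * tnth (x G n w) i.
  by rewrite summxE; apply: eq_bigr => n _; rewrite !mxE.
have msc G i : measurable_fun setT (fun w => score_sum G w i 0).
  under eq_fun do rewrite scE.
  by apply: measurable_sum => n; exact: measurable_funM.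
have scae G i : {ae P G, forall w, sc' G i w = score_sum G w i 0}.
  apply: filterS (aeE G) => w wE; rewrite scE; apply: eq_bigr => n _.
  by have [xE uE] := wE n; rewrite xE uE.
(* The score sum has mean zero by exogeneity, so covariances are plain second moments and can be
   computed from the clipped scores. *)
have varE G i j : var_mx (P G) (score_sum G) i j = expect (P G) (fun w => sc' G i w * sc' G j w).
  have Esc l : fine (expectation (P G) (fun w => score_sum G w l 0)) = 0.
    rewrite expectation.unlock; transitivity (expect (P G) (sc' G l)).
      by apply/esym/expect_ae => //; have [] := bsc G l.
    rewrite expect_sum; last by move=> n; bounded_mfun_tac.
    by rewrite big1.
  rewrite mxE covariance.unlock !Esc expectation.unlock.
  have -> : ((fun w => score_sum G w i 0) \- cst 0) * ((fun w => score_sum G w j 0) \- cst 0) =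
      (fun w => score_sum G w i 0 * score_sum G w j 0).
    by apply/funext => w; rewrite /GRing.mul/= !subr0.
  apply/esym/expect_ae.
  - by have [] := bounded_mfunM (bsc G i) (bsc G j).
  - exact: measurable_funM.
  - by apply: filterS2 (scae G i) (scae G j) => w -> ->.
have main (a Dl : nat -> R) : (\forall G \near \oo, 1 <= a G) ->
    (\forall G \near \oo, a G <= Dl G) ->
    (forall G, (max_dyads_of (psi G))%:R <= Dl G) ->
    Dl G ^+ 3 / ((N G)%:R * a G ^+ 2) @[G --> \oo] --> (0 : R) ->
    posdef_limit (fun G => ((N G)%:R * a G)^-1 *: var_mx (P G) (score_sum G)) ->
    cvg_in_distribution t (normal_prob 0 1).
  move=> a1 aDl mDl rate [Om limOm Ompd].
  have vOm i j : expect (P G) (fun w => sc' G i w * sc' G j w) / ((N G)%:R * a G)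
      @[G --> \oo] --> Om i j.
    have scaleE (b : R) (M : 'M[R]_K) : (b *: M) i j = b * M i j by rewrite mxE.
    have := @mcvg_entries _ _ _ _ limOm i j; apply: cvg_trans; apply: near_eq_cvg; near=> G.
    by rewrite scaleE varE mulrC.
  apply: cvg_in_distribution_squeeze => s eta del eta0 del0.
  apply: (@tstat_cdf R K d T P N psi dyads _ _ xu mxu _ x' u' B kx ku _ _ B0 Q EQ E0
    (full_rank G0 n0) a Dl N_infty a1 aDl mDl rate Om vOm Ompd k beta (fun G => t G)) => //.
  - move=> G S1 S2 h; apply: dyadic_dependence => //.
    (* Disjointness is automatic: a dyad in both sets would share a unit with itself. *)
    rewrite -setI_eq0; apply/eqP/setP => n; rewrite !inE; apply/negP => /andP[nS1 nS2].
    by have := h n n nS1 nS2; rewrite share_unit_refl.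
  - by move=> G n i w; exact: clip_bound.
  - by move=> G n w; exact: clip_bound.
  move=> G; apply: filterS (aeE G) => w wE ug V0.
  have xE : (fun n => \col_i x' G n i w) = xv G ^~ w.
    by apply/funext => n; apply/colP => i; rewrite !mxE; have [-> _] := wE n.
  have yE : (fun n => dot beta (\col_i x' G n i w) + u' G n w) = y G ^~ w.
    apply/funext => n; rewrite model; have [_ ->] := wE n; congr (dot _ _ + _).
    by have /(congr1 (fun f => f n)) := xE.
  move: ug V0 => /=; rewrite xE yE => ug V0.
  by rewrite tE// !mxE.
have N0 : \forall G \near \oo, 0 < (N G)%:R :> R.
  have : \forall G \near \oo, (0 < N G)%N.
    by move: N_infty => /(_ [set m | 0 < m]%N); apply; exact: nbhs_infty_gt.
  by apply: filterS => G; rewrite ltr0n.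
have dense : (exists2 c : R, 0 < c &
      forall G, (2 <= G)%N -> c * G%:R <= (min_dyads_of (psi G))%:R) ->
    forall r : R, 0 <= r <= 1 -> 1 / 2 < r ->
    posdef_limit (fun G => ((N G)%:R * (G%:R `^ r))^-1 *: var_mx (P G) (score_sum G)) ->
    cvg_in_distribution t (normal_prob 0 1).
  move=> [c c0 cG] r /andP[r0 r1] r12; apply: (main _ (fun G => G%:R)).
  - near=> G; have G1 : 1 <= G%:R :> R by rewrite ler1n; near: G; exact: nbhs_infty_gt.
    by have := ler_powR G1 r0; rewrite powRr0.
  - near=> G; have G1 : 1 <= G%:R :> R by rewrite ler1n; near: G; exact: nbhs_infty_gt.
    exact: ler1_powR.
  - by move=> G; rewrite ler_nat; exact: max_dyads_of_le.
  - have r21 : 0 < 2 * r - 1 by lra.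
    (* Since [N >= c / 2 * G ^+ 2], the rate [G ^+ 3 / (N * G ^ (2 r))] is at most
       [2 / c * G ^ (1 - 2 r)]. *)
    apply: (@cvg_le0 _ _ _ _ _ (fun G => 2 / c * (G%:R `^ (2 * r - 1))^-1)); last first.
      rewrite -[X in _ --> X](mulr0 (2 / c)); apply: cvgM; first exact: cvg_cst.
      exact: invr_natr_powR_cvg0.
    near=> G.
    have G2 : (2 <= G)%N by near: G; exact: nbhs_infty_ge.
    have G0' : 0 < G%:R :> R by rewrite ltr0n (leq_trans _ G2).
    have NG : c / 2 * G%:R ^+ 2 <= (N G)%:R := dyads_lower_bound (dyads G) (cG G G2).
    have NG0 : 0 < (N G)%:R :> R by near: G.
    have ar0 : 0 < G%:R `^ r :> R by rewrite powR_gt0.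
    rewrite ger0_norm; last by rewrite divr_ge0 ?exprn_ge0// mulr_ge0 ?exprn_ge0// ltW.
    have -> : (G%:R `^ (2 * r - 1))^-1 = G%:R / (G%:R `^ r) ^+ 2 :> R.
      rewrite powRB ?(gt_eqF G0') ?implybT// powRr1 ?(ltW G0')//.
      by rewrite [2 * r]mulrC powRrM powR_mulrn ?(ltW ar0)// invfM invrK mulrC.
    rewrite ler_pdivrMr ?mulr_gt0 ?exprn_gt0//.
    rewrite [leRHS](_ : _ = 2 / c * G%:R * (N G)%:R); last by field; rewrite !gt_eqF.
    apply: (@le_trans _ _ (2 / c * G%:R * (c / 2 * G%:R ^+ 2))).
      by rewrite le_eqVlt; apply/orP; left; apply/eqP; field; rewrite gt_eqF.
    by rewrite ler_wpM2l// mulr_ge0 ?divr_ge0// ltW.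
case: regimes => [[[D mD] lim]|[cG lim]|[cG [r [r01 r12 lim]]]].
(* The maximum with 1 secures [a <= Dl]; the rate is then a constant over [N]. *)
- apply: (main (fun=> 1) (fun=> Num.max 1 D)).
  + by near=> G.
  + by near=> G; rewrite le_max lexx.
  + by move=> G; rewrite le_max (ltW (mD G)) orbT.
  + rewrite -[X in _ --> X](mulr0 (Num.max 1 D ^+ 3)); apply: cvgM; first exact: cvg_cst.
    under eq_fun do rewrite expr1n mulr1.
    apply/gtr0_cvgV0 => //; apply/cvgryPge => M.
    have /cvgryPge/(_ M) := @cvgr_idn R.
    move=> [m _ mM]; have : \forall G \near \oo, (m <= N G)%N.
      by move: N_infty => /(_ [set j | m <= j]%N); apply; exact: nbhs_infty_ge.
    by apply: filterS => G /mM.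
  + by under eq_fun do rewrite mulr1.
(* The second regime is the third with exponent [r = 1]. *)
- apply: (dense cG 1); [by rewrite ler01 lexx|lra|].
  by under eq_fun do rewrite powRr1//.
- exact: dense cG r r01 r12 lim.
Unshelve. all: by end_near. Qed.
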